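(* Let $\mathcal H$ be a finite-dimensional Hilbert space of dimension $N$. For every $r\in(0,1]$ and every $\mu\in\mathcal P^\infty(\mathbb P)$, $$P_r(\mu)\prec_wP_r(\lambda_*\mu).$$
   Context: $\mathbb P=\mathbb P(\mathcal H)$ is the set of positive invertible operators on $\mathcal H$ (positive definite $N\times N$ matrices). $\mathcal P^\infty(\mathbb P)$ is the set of Borel probability measures $\mu$ on $\mathbb P$ whose support is contained in $\{A:\varepsilon I\le A\le\varepsilon^{-1}I\}$ for some $\varepsilon\in(0,1)$. For $r\in(0,1]$ the power mean $P_r(\mu)$ is the unique $X\in\mathbb P$ satisfying $X=\int_{\mathbb P}X\#_rA\,d\mu(A)$, where $X\#_rA=X^{1/2}(X^{-1/2}AX^{-1/2})^rX^{1/2}$ is the weighted geometric mean. For $A\in\mathbb P$, $\lambda(A)=(\lambda_1(A),\dots,\lambda_N(A))$ is the vector of eigenvalues in decreasing order with multiplicities, identified with the diagonal matrix having these diagonal entries. $\lambda_*\mu$ is the push-forward of $\mu$ by $A\mapsto\lambda(A)$; one has $P_r(\lambda_*\mu)=\bigl([\int_{\mathbb P}\lambda_i(A)^r\,d\mu(A)]^{1/r}\bigr)_{i=1}^N$. For $A,B\in\mathbb P$, $A\prec_wB$ (weak majorization) means $\sum_{i=1}^k\lambda_i(A)\le\sum_{i=1}^k\lambda_i(B)$ for $1\le k\le N$. *)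

(* Defs.v *)
From HB Require Import structures.
From mathcomp Require Import all_boot all_order all_algebra.
From mathcomp Require Import complex sesquilinear spectral.
From mathcomp Require Import all_classical all_reals all_analysis.

Set Implicit Arguments.
Unset Strict Implicit.
Unset Printing Implicit Defensive.

Import Order.TTheory GRing.Theory Num.Theory.
Import numFieldTopology.Exports numFieldNormedType.Exports.

Local Open Scope classical_set_scope.
Local Open Scope ring_scope.
Local Open Scope sesquilinear_scope.
Local Open Scope complex_scope.

(* R[i], packaged as a numClosedFieldType so that the norm topology declared
   for abstract numeric fields is inferred on it and on matrices over it. *)
Definition Cx (R : realType) : numClosedFieldType := R[i].

Section matrices.
Context {R : realType} {N : nat}.
Local Notation C := (Cx R).
Implicit Types A B X : 'M[C]_N.

(* < A v, v > *)
Definition qform A (v : 'cV[C]_N) : C := (v ^t* *m A *m v) 0 0.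

(* The order of C makes 0 <= z and 0 < z imply that z is real. *)
Definition possemidef A : Prop :=
  A \is hermsymmx /\ forall v : 'cV[C]_N, 0 <= qform A v.

Definition posdef A : Prop :=
  A \is hermsymmx /\ forall v : 'cV[C]_N, v != 0 -> 0 < qform A v.

Definition loewner_le A B : Prop := possemidef (B - A).

(* Functional calculus for Hermitian A = U^-1 diag(d) U, U unitary, d real. *)
Definition mxfun (f : R -> R) A : 'M[C]_N :=
  invmx (spectralmx A)
  *m diag_mx (map_mx (fun z : C => (f (complex.Re z))%:C : C) (spectral_diag A))
  *m spectralmx A.

Definition mxpow A (t : R) : 'M[C]_N := mxfun (fun x => x `^ t) A.

Definition wgeomean (r : R) X A : 'M[C]_N :=
  mxpow X 2^-1 *m mxpow (mxpow X (- 2^-1) *m A *m mxpow X (- 2^-1)) r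
  *m mxpow X 2^-1.

(* Eigenvalues of a Hermitian matrix with multiplicities, in decreasing order. *)
Definition eigvals A : 'rV[R]_N :=
  \row_(i < N) (sort >=%O
    [seq complex.Re (spectral_diag A 0 j : R[i]) | j <- enum 'I_N])`_i.

Definition weak_major A B : Prop :=
  forall k : nat, (1 <= k <= N)%N ->
    \sum_(i < N | (i < k)%N) eigvals A 0 i
      <= \sum_(i < N | (i < k)%N) eigvals B 0 i.

End matrices.

Notation "A ≺w B" := (weak_major A B) (at level 70).

(* The space P of positive definite N x N matrices, with the topology induced
   from that of all matrices. *)
Definition PD (R : realType) (N : nat) : Type :=
  set_type (@posdef R N : set 'M[Cx R]_N).

HB.instance Definition _ (R : realType) (N : nat) :=
  Topological.copy (PD R N) (set_type (@posdef R N : set 'M[Cx R]_N)).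

Definition mx_of_PD (R : realType) (N : nat) (A : PD R N) : 'M[Cx R]_N :=
  set_val A.
Coercion mx_of_PD : PD >-> matrix.

Section posdef_facts.
Context {R : realType} {N : nat}.
Local Notation C := (Cx R).

Lemma posdef_spectral_diag (A : 'M[C]_N) (i : 'I_N) :
  posdef A -> 0 < spectral_diag A 0 i.
Proof.
move=> [hA pA].
pose P := spectralmx A.
have Pu : P \is unitarymx := spectral_unitarymx A.
have AE : A = invmx P *m diag_mx (spectral_diag A) *m P.
  exact/orthomx_spectralP/hermitian_normalmx.
pose v : 'cV[C]_N := invmx P *m delta_mx i 0.
have Pv : P *m v = delta_mx i 0 by rewrite mulKVmx ?spectral_unit.
have v0 : v != 0.
  apply/eqP => v0; move: Pv; rewrite v0 mulmx0 => /matrixP /(_ i 0).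
  by rewrite !mxE !eqxx => /eqP; rewrite eq_sym oner_eq0.
have := pA v v0.
rewrite /qform [in X in 0 < X -> _]AE (invmx_unitary Pu).
move: (spectral_diag A) => d; clearbody v.
have -> : v ^t* *m (P ^t* *m diag_mx d *m P) *m v
    = (P *m v) ^t* *m (diag_mx d *m (P *m v)).
  by rewrite [in RHS]trmx_mul map_mxM !mulmxA.
rewrite Pv trmx_delta map_delta_mx -rowE mxE mul_diag_mx !mxE !eqxx.
by rewrite mulr1.
Qed.

Lemma eigvals_gt0 (A : 'M[C]_N) (i : 'I_N) : posdef A -> 0 < eigvals A 0 i.
Proof.
move=> pA; rewrite mxE; set s := sort _ _.
have : s`_i \in s by rewrite mem_nth// size_sort size_map size_enum_ord.
rewrite mem_sort => /mapP[j _ ->].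
by have := posdef_spectral_diag j pA; rewrite ltcE => /andP[].
Qed.

Lemma posdef_diag (d : 'rV[R]_N) : (forall i, 0 < d 0 i) ->
  posdef (diag_mx (map_mx (fun x : R => x%:C : C) d)).
Proof.
move=> d0; split.
  apply/is_hermitianmxP; rewrite expr0 scale1r tr_diag_mx map_diag_mx.
  congr diag_mx; apply/rowP => i; rewrite !mxE.
  by apply/esym/CrealP/complex_realP; exists (d 0 i).
move=> v v0; rewrite /qform -mulmxA mxE.
have d0C i : 0 < (d 0 i)%:C :> R[i] by rewrite ltcR.
have E i : (v ^t*) 0 i * (diag_mx (map_mx (fun x : R => x%:C : C) d) *m v) i 0
    = ((d 0 i)%:C : C) * `|v i 0| ^+ 2.
  by rewrite mul_diag_mx !mxE mulrCA normCK [_^* * _]mulrC.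
have [i vi0] : exists i, v i 0 != 0.
  apply/existsP; rewrite -negb_forall; apply: contra v0 => /forallP v0.
  by apply/eqP/matrixP => i j; rewrite ord1 !mxE; exact/eqP.
rewrite (bigD1 i)//= ltr_wpDr//.
  apply: sumr_ge0 => j _; rewrite E mulr_ge0 ?exprn_ge0//.
  exact: ltW (d0C j).
by rewrite E mulr_gt0 ?exprn_gt0 ?normr_gt0//; exact: (d0C i).
Qed.

Definition diagPD (d : 'rV[R]_N) (d0 : forall i, 0 < d 0 i) : PD R N :=
  SigSub (mem_set (posdef_diag d0)).

Lemma PD_posdef (A : PD R N) : posdef (A : 'M[C]_N).
Proof. by case: A => A pA; exact: set_mem pA. Qed.

(* A |-> lambda(A), the vector of eigenvalues being seen as a diagonal matrix *)
Definition eigdiag (A : PD R N) : PD R N :=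
  diagPD (fun i => eigvals_gt0 i (PD_posdef A)).

End posdef_facts.

HB.instance Definition _ (R : realType) (N : nat) :=
  isPointed.Build (PD R N)
    (@diagPD R N (const_mx 1)
       (fun i => eq_ind_r (fun x : R => 0 < x) ltr01 (mxE _ _ _ _))).

Definition borel (T : ptopologicalType) := g_sigma_algebraType (@open T).

Definition msupport (R : realType) (T : ptopologicalType)
    (mu : set (borel T) -> \bar R) : set T :=
  [set x | forall U : set T, open U -> U x -> (0 < mu U)%E].

Section power_mean.
Context {R : realType} {N : nat}.
Local Notation C := (Cx R).
Local Notation BPD := (borel (PD R N)).

(* The probability measures mu satisfying this form P^oo(P). *)
Definition bounded_support (mu : set BPD -> \bar R) : Prop :=
  exists e : R, [/\ 0 < e, e < 1 &
    msupport mu `<=` [set A : PD R N |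
      loewner_le (e%:C : C)%:M A /\ loewner_le A (e^-1%:C : C)%:M]].

(* Entrywise integral of a matrix-valued function *)
Definition mxintegral (mu : set BPD -> \bar R) (F : PD R N -> 'M[C]_N) :
    'M[C]_N :=
  \matrix_(i, j)
    (Complex (fine (\int[mu]_(A in [set: BPD]) (complex.Re (F A i j : R[i]))%:E)%E)
             (fine (\int[mu]_(A in [set: BPD]) (complex.Im (F A i j : R[i]))%:E)%E)
     : C).

(* lambda_* mu *)
Definition eig_pushforward (mu : set BPD -> \bar R) : set BPD -> \bar R :=
  pushforward mu (eigdiag : BPD -> BPD).

(* [get] picks the solution X, which exists and is unique when 0 < r <= 1 and
   mu is a Borel probability measure of bounded support. The argument mu is a
   bare set function so that this applies to [eig_pushforward mu] without
   a proof that eigdiag is measurable. *)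
Definition power_mean (r : R) (mu : set BPD -> \bar R) : PD R N :=
  get [set X : PD R N | X = mxintegral mu (fun A => wgeomean r X A) :> 'M[C]_N].

End power_mean.

(* Main.v *)
(** Write [X #_r A] for [wgeomean r X A] and let [X] be a power mean of [mu].
    Summing [X = int (X #_r A) dmu(A)] over orthonormal eigenvectors of [X] for
    its [k] largest eigenvalues, Ky Fan's principle bounds the [k]-th partial sum
    of [lambda(X)] by the integral of that of [lambda(X #_r A)]. The Cauchy-Binet
    formula and Jensen's inequality give
    [det (V^* (X #_r A) V) <= det (V^* X V)^(1-r) det (V^* A V)^r], hence the
    log-majorization of [lambda(X #_r A)] by [lambda(X)^(1-r) lambda(A)^r] and
    then weak majorization. With [d_i = (int lambda_i(A)^r dmu)^(1/r)], Young's
    inequality turns [sum x_i <= sum x_i^(1-r) d_i^r] into [sum x_i <= sum d_i].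

    Existence of [X], and [diag d <= Y] for every solution [Y] of the equation
    for [lambda_* mu], follow from the monotonicity and the homogeneity of degree
    [1 - r] of [X |-> int (X #_r A) dmu(A)], that is from the Loewner-Heinz
    inequality. The same two properties in [A] give the continuity needed for
    measurability. *)

Require Import Defs.
From HB Require Import structures.
From mathcomp Require Import all_boot all_order all_algebra perm.
From mathcomp Require Import complex sesquilinear spectral ring lra.
From mathcomp Require Import all_classical all_reals all_analysis.

Set Implicit Arguments.
Unset Strict Implicit.
Unset Printing Implicit Defensive.

Import Order.TTheory GRing.Theory Num.Theory.
Import numFieldTopology.Exports numFieldNormedType.Exports.

Local Open Scope classical_set_scope.
Local Open Scope ring_scope.
Local Open Scope sesquilinear_scope.

(** The value of [power_mean] is picked by [get], so nothing can be said about it before some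
    solution of its equation is exhibited; afterwards the equation is all that is known. Hence a
    solution is built for [mu] by monotone iteration and for the pushforward by an explicit diagonal
    matrix, and both bounds are proved for arbitrary positive definite solutions.

    The Loewner order, integrals and limits of matrices are all read through the real quadratic
    forms [rq]; polarization recovers the entries of a Hermitian matrix from them, so each analytic
    statement becomes one about real functions.

    A perturbation theory of matrix powers is avoided: every [B] close to a positive definite [A]
    satisfies [(1 - t) A <= B <= (1 + t) A] with [t] small, and monotonicity with homogeneity
    carries such a bound through geometric means, the mean map and Ky Fan sums.

    The support condition bounds only the points of the support, and a countable base of rational
    boxes turns it into an almost everywhere bound. *)

Definition rc {R : realType} (x : R) : Cx R := Complex x 0.
Definition re {R : realType} (z : Cx R) : R := complex.Re (z : R[i]).
Definition im {R : realType} (z : Cx R) : R := complex.Im (z : R[i]).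

(* The definitions below are locked because conversion would otherwise unfold
   matrix expressions down to their representation. *)
HB.lock Definition sq {R : realType} (z : Cx R) : R := re z ^+ 2 + im z ^+ 2.
HB.lock Definition herm {R : realType} {n} (A : 'M[Cx R]_n) : Prop := A^t* = A.
HB.lock Definition rdiag {R : realType} {n} (d : 'rV[R]_n) : 'M[Cx R]_n :=
  diag_mx (map_mx rc d).
HB.lock Definition rq {R : realType} {n} (A : 'M[Cx R]_n) (v : 'cV[Cx R]_n) : R :=
  re (qform A v).
HB.lock Definition nrm2 {R : realType} {n} (v : 'cV[Cx R]_n) : R := \sum_i sq (v i 0).
HB.lock Definition sesq {R : realType} {n} (A : 'M[Cx R]_n) (u v : 'cV[Cx R]_n) : Cx R :=
  (u^t* *m A *m v) 0 0.
HB.lock Definition pd {R : realType} {n} (A : 'M[Cx R]_n) : Prop := posdef A.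

(** * Real and imaginary parts *)

Section embedding.
Context {R : realType}.
Local Notation C := (Cx R).

Fact rc_is_zmod_morphism : zmod_morphism (@rc R).
Proof. by move=> x y; rewrite -[LHS]/(real_complex R (x - y)) rmorphB. Qed.
Fact rc_is_monoid_morphism : monoid_morphism (@rc R).
Proof.
by split=> // x y; rewrite -[LHS]/(real_complex R (x * y)) rmorphM.
Qed.
HB.instance Definition _ := GRing.isZmodMorphism.Build R C rc rc_is_zmod_morphism.
HB.instance Definition _ := GRing.isMonoidMorphism.Build R C rc rc_is_monoid_morphism.

Fact re_is_zmod_morphism : zmod_morphism (@re R).
Proof. by case=> a b [c d]. Qed.
Fact im_is_zmod_morphism : zmod_morphism (@im R).
Proof. by case=> a b [c d]. Qed.
HB.instance Definition _ := GRing.isZmodMorphism.Build C R re re_is_zmod_morphism.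
HB.instance Definition _ := GRing.isZmodMorphism.Build C R im im_is_zmod_morphism.

Lemma rcK : cancel (@rc R) (@re R). Proof. by []. Qed.
Lemma re_rcM (x : R) (z : C) : re (rc x * z) = x * re z.
Proof. by case: z => a b; rewrite /re /= mul0r subr0. Qed.
Lemma conj_rc (x : R) : (rc x)^* = rc x.
Proof. exact: (conjc_real x). Qed.
Lemma re_conj (z : C) : re z^* = re z. Proof. by case: z. Qed.
Lemma im_conj (z : C) : im z^* = - im z. Proof. by case: z. Qed.
Lemma eq_re_im (z w : C) : re z = re w -> im z = im w -> z = w.
Proof. by case: z w => a b [c d]; rewrite /re /im /= => -> ->. Qed.
Lemma conj_fix_rc (z : C) : z^* = z -> z = rc (re z).
Proof.
move=> h; apply: eq_re_im => //; have := im_conj z; rewrite h.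
by rewrite /rc {3}/im /= => /eqP; rewrite -addr_eq0 -mulr2n mulrn_eq0 => /eqP.
Qed.

Lemma sqE (z : C) : z^* * z = rc (sq z).
Proof.
by rewrite sq.unlock mulrC -normCK; exact/esym/(add_Re2_Im2 (z : R[i])).
Qed.
Lemma sq_ge0 (z : C) : 0 <= sq z. Proof. by rewrite sq.unlock addr_ge0 ?sqr_ge0. Qed.
Lemma sq_eq0 (z : C) : (sq z == 0) = (z == 0).
Proof.
rewrite sq.unlock paddr_eq0 ?sqr_ge0// !sqrf_eq0; apply/andP/eqP => [[/eqP h /eqP h']|->].
  by apply: eq_re_im; rewrite ?h ?h'.
by rewrite !raddf0.
Qed.

Lemma rc_gt0 (x : R) : (0 < rc x) = (0 < x). Proof. exact: (ltcR 0 x). Qed.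
Lemma rc_ge0 (x : R) : (0 <= rc x) = (0 <= x). Proof. exact: (lecR 0 x). Qed.

End embedding.

(** * Hermitian forms, the Loewner order and polarization *)

Section forms.
Context {R : realType}.
Local Notation C := (Cx R).

Lemma hermsymmxP n (A : 'M[C]_n) : A \is hermsymmx <-> herm A.
Proof.
by rewrite herm.unlock; split=> [/is_hermitianmxP|h]; [|apply/is_hermitianmxP]; rewrite expr0 scale1r.
Qed.

(** The Loewner order without its Hermitian side condition, which is supplied separately where it
    matters, as for antisymmetry. *)
Definition lel n (A B : 'M[C]_n) := forall v, rq A v <= rq B v.

Lemma hermK n (A : 'M[C]_n) : herm A -> A^t* = A.
Proof. by rewrite herm.unlock. Qed.

Lemma adjM m n p (A : 'M[C]_(m, n)) (B : 'M[C]_(n, p)) :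
  (A *m B)^t* = B^t* *m A^t*.
Proof. by rewrite trmx_mul map_mxM. Qed.

Lemma herm_conj m n (A : 'M[C]_m) (W : 'M[C]_(m, n)) :
  herm A -> herm (W^t* *m A *m W).
Proof. by rewrite !herm.unlock => hA; rewrite !adjM trmxCK hA !mulmxA. Qed.

Lemma hermD n (A B : 'M[C]_n) : herm A -> herm B -> herm (A + B).
Proof. by rewrite !herm.unlock linearD /= map_mxD => -> ->. Qed.

Lemma hermN n (A : 'M[C]_n) : herm A -> herm (- A).
Proof. by rewrite !herm.unlock linearN /= map_mxN => ->. Qed.

Lemma hermZ n c (A : 'M[C]_n) : herm A -> herm (rc c *: A).
Proof. by rewrite !herm.unlock linearZ /= map_mxZ /= conj_rc => ->. Qed.

Lemma herm_rdiag n (d : 'rV[R]_n) : herm (rdiag d).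
Proof.
rewrite !herm.unlock rdiag.unlock tr_diag_mx map_diag_mx; congr diag_mx.
by apply/rowP => i; rewrite !mxE /= conj_rc.
Qed.

Lemma hermE n (A : 'M[C]_n) i j : herm A -> A i j = (A j i)^*.
Proof. by move=> hA; rewrite -{1}(hermK hA) !mxE. Qed.

Lemma qform_herm n (A : 'M[C]_n) v : herm A -> qform A v = rc (rq A v).
Proof.
move=> hA; rewrite rq.unlock; apply: conj_fix_rc.
have h : (v^t* *m A *m v)^t* = v^t* *m A *m v by apply: hermK; exact: herm_conj.
by rewrite /qform -[in RHS]h !mxE.
Qed.

Lemma rqD n (A B : 'M[C]_n) v : rq (A + B) v = rq A v + rq B v.
Proof. by rewrite !rq.unlock /qform mulmxDr mulmxDl mxE raddfD. Qed.
Lemma rqN n (A : 'M[C]_n) v : rq (- A) v = - rq A v.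
Proof. by rewrite !rq.unlock /qform mulmxN mulNmx mxE raddfN. Qed.
Lemma rqB n (A B : 'M[C]_n) v : rq (A - B) v = rq A v - rq B v.
Proof. by rewrite rqD rqN. Qed.
Lemma rqZ n c (A : 'M[C]_n) v : rq (rc c *: A) v = c * rq A v.
Proof. by rewrite !rq.unlock /qform -scalemxAr -scalemxAl mxE re_rcM. Qed.
Lemma rq_conj m n (A : 'M[C]_m) (W : 'M[C]_(m, n)) v :
  rq (W^t* *m A *m W) v = rq A (W *m v).
Proof. by rewrite !rq.unlock /qform adjM !mulmxA. Qed.

Lemma rq_sandwich n (A W : 'M[C]_n) v : herm W -> rq (W *m A *m W) v = rq A (W *m v).
Proof. by move=> hW; rewrite -{1}(hermK hW) rq_conj. Qed.

Lemma rq_rdiag n (d : 'rV[R]_n) v : rq (rdiag d) v = \sum_i d 0 i * sq (v i 0).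
Proof.
rewrite !rq.unlock /qform -mulmxA mxE raddf_sum /=; apply: eq_bigr => i _.
by rewrite rdiag.unlock mul_diag_mx !mxE mulrCA sqE re_rcM rcK.
Qed.

Lemma rdiag_const n c : rdiag (const_mx c) = (rc c)%:M :> 'M[C]_n.
Proof.
by rewrite rdiag.unlock -diag_const_mx; congr diag_mx; apply/rowP => i; rewrite !mxE.
Qed.

Lemma rq_scalar n c v : rq ((rc c)%:M : 'M[C]_n) v = c * nrm2 v.
Proof.
rewrite -rdiag_const rq_rdiag nrm2.unlock mulr_sumr; apply: eq_bigr => i _.
by rewrite mxE.
Qed.

Lemma rq1 n v : rq (1%:M : 'M[C]_n) v = nrm2 v.
Proof. by rewrite -[1%:M]/((rc 1)%:M) rq_scalar mul1r. Qed.

Lemma nrm2_ge0 n (v : 'cV[C]_n) : 0 <= nrm2 v.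
Proof. by rewrite nrm2.unlock; apply: sumr_ge0 => i _; exact: sq_ge0. Qed.

Lemma nrm2_gt0 n (v : 'cV[C]_n) : v != 0 -> 0 < nrm2 v.
Proof.
move=> v0; rewrite lt_neqAle nrm2_ge0 andbT eq_sym; apply: contra v0 => /eqP.
rewrite nrm2.unlock; move/psumr_eq0P => h; apply/eqP/colP => i; rewrite mxE.
by apply/eqP; rewrite -sq_eq0 h// => j _; exact: sq_ge0.
Qed.

Lemma rqv0 n (A : 'M[C]_n) : rq A 0 = 0.
Proof. by rewrite !rq.unlock /qform mulmx0 mxE raddf0. Qed.

Lemma posdefP n (A : 'M[C]_n) :
  pd A <-> herm A /\ forall v, v != 0 -> 0 < rq A v.
Proof.
rewrite pd.unlock; split=> [[/hermsymmxP hA pA]|[hA pA]]; split=> //.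
- by move=> v /pA; rewrite qform_herm// rc_gt0.
- exact/hermsymmxP.
- by move=> v /pA; rewrite qform_herm// rc_gt0.
Qed.

Lemma posdef_herm n (A : 'M[C]_n) : pd A -> herm A.
Proof. by move/posdefP=> []. Qed.

Lemma posdef_rq n (A : 'M[C]_n) v : pd A -> v != 0 -> 0 < rq A v.
Proof. by move/posdefP=> [_]; apply. Qed.

Lemma posdef_rq_ge0 n (A : 'M[C]_n) v : pd A -> 0 <= rq A v.
Proof.
move=> pA; have [->|/(posdef_rq pA)/ltW//] := eqVneq v 0.
by rewrite rqv0.
Qed.

Lemma loewner_le_lel n (A B : 'M[C]_n) : loewner_le A B -> lel A B.
Proof.
move=> [/hermsymmxP h p] v; rewrite -subr_ge0 -rqB; have := p v.
by rewrite qform_herm// rc_ge0.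
Qed.

Lemma lel_trans n (B A D : 'M[C]_n) : lel A B -> lel B D -> lel A D.
Proof. by move=> h h' v; exact: le_trans (h v) (h' v). Qed.
Lemma lel_sandwich n (A B W : 'M[C]_n) : herm W -> lel A B ->
  lel (W *m A *m W) (W *m B *m W).
Proof. by move=> hW h v; rewrite !rq_sandwich. Qed.

Lemma posdef_le n (A B : 'M[C]_n) : pd A -> herm B -> lel A B -> pd B.
Proof.
move=> pA hB AB; apply/posdefP; split=> // v v0.
exact: lt_le_trans (posdef_rq pA v0) (AB v).
Qed.

(** Polarization vectors: the forms at [pv1], [pv2] and the basis vectors give the real and
    imaginary parts of the entries of a Hermitian matrix. *)
Definition pv1 n (i j : 'I_n) : 'cV[C]_n := delta_mx i 0 + delta_mx j 0.
Definition pv2 n (i j : 'I_n) : 'cV[C]_n := delta_mx i 0 + 'i *: delta_mx j 0.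

Lemma sesq_delta n (A : 'M[C]_n) (i j : 'I_n) :
  sesq A (delta_mx i 0) (delta_mx j 0) = A i j.
Proof. by rewrite sesq.unlock trmx_delta map_delta_mx -rowE -colE !mxE. Qed.

Lemma rq_sesq n (A : 'M[C]_n) u : rq A u = re (sesq A u u).
Proof. by rewrite rq.unlock sesq.unlock. Qed.

Lemma sesqDl n (A : 'M[C]_n) u u' v : sesq A (u + u') v = sesq A u v + sesq A u' v.
Proof. by rewrite sesq.unlock [(u + u')^T]linearD /= map_mxD !mulmxDl mxE. Qed.

Lemma sesqDr n (A : 'M[C]_n) u v v' : sesq A u (v + v') = sesq A u v + sesq A u v'.
Proof. by rewrite sesq.unlock mulmxDr mxE. Qed.

Lemma sesqZl n (A : 'M[C]_n) c u v : sesq A (c *: u) v = c^* * sesq A u v.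
Proof. by rewrite sesq.unlock [(c *: u)^T]linearZ /= map_mxZ -!scalemxAl mxE. Qed.

Lemma sesqZr n (A : 'M[C]_n) c u v : sesq A u (c *: v) = c * sesq A u v.
Proof. by rewrite sesq.unlock -scalemxAr mxE. Qed.

Lemma rq_delta n (A : 'M[C]_n) i : rq A (delta_mx i 0) = re (A i i).
Proof. by rewrite rq_sesq sesq_delta. Qed.

Lemma mx00Z c (A : 'M[C]_1) : (c *: A) 0 0 = c * A 0 0.
Proof. by rewrite mxE. Qed.

Lemma re_polar n (A : 'M[C]_n) i j : herm A ->
  re (A i j) = (rq A (pv1 i j) - rq A (delta_mx i 0) - rq A (delta_mx j 0)) / 2.
Proof.
move=> hA; rewrite !rq_delta rq_sesq /pv1 sesqDl !sesqDr !sesq_delta.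
rewrite (hermE j i hA) !raddfD /= re_conj.
move: (re _) (re _) (re _) => x y z; lra.
Qed.

Lemma re_i z : re ('i * z) = - im z :> R.
Proof. by case: z => a b; rewrite /re /im /= mul0r mul1r sub0r. Qed.

Lemma im_polar n (A : 'M[C]_n) i j : herm A ->
  im (A i j) = (rq A (delta_mx i 0) + rq A (delta_mx j 0) - rq A (pv2 i j)) / 2.
Proof.
move=> hA; rewrite !rq_delta rq_sesq /pv2 sesqDl !sesqDr !sesqZl !sesqZr.
rewrite !sesq_delta conjCi !mulrA !mulNr -expr2 sqrCi mulN1r opprK.
rewrite (hermE j i hA) !raddfD raddfN /= !re_i im_conj.
move: (re _) (re _) (im _) => x y z; lra.
Qed.

Lemma herm_rq_eq n (A B : 'M[C]_n) : herm A -> herm B -> (forall v, rq A v = rq B v) ->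
  A = B.
Proof.
move=> hA hB AB; apply/matrixP => i j.
by apply: eq_re_im; rewrite ?re_polar// ?im_polar// !AB.
Qed.

Lemma lel_anti n (A B : 'M[C]_n) : herm A -> herm B -> lel A B -> lel B A -> A = B.
Proof. by move=> hA hB AB BA; apply: herm_rq_eq => // v; apply/eqP; rewrite eq_le AB BA. Qed.

End forms.

(** * Functional calculus of Hermitian matrices *)

(** [U] may be rectangular, so that a compression [V^* A V] of a diagonalized [A] has the same
    shape; Cauchy-Binet is applied to such compressions. *)
HB.lock Definition spec {R : realType} {m n} (U : 'M[Cx R]_(m, n)) (d : 'rV[R]_m) :
  'M[Cx R]_n := U^t* *m rdiag d *m U.

HB.lock Definition mpw {R : realType} {n} (A : 'M[Cx R]_n) t := mxpow A t.

Section spectral.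
Context {R : realType}.
Local Notation C := (Cx R).

Lemma specE m n (U : 'M[C]_(m, n)) d i j :
  spec U d i j = \sum_l (U l i)^* * rc (d 0 l) * U l j.
Proof.
rewrite spec.unlock mxE; apply: eq_bigr => l _.
by rewrite rdiag.unlock mul_mx_diag !mxE.
Qed.

Lemma herm_spec m n (U : 'M[C]_(m, n)) d : herm (spec U d).
Proof. by rewrite spec.unlock; exact/herm_conj/herm_rdiag. Qed.

Lemma rq_spec m n (U : 'M[C]_(m, n)) d v :
  rq (spec U d) v = \sum_i d 0 i * sq ((U *m v) i 0).
Proof. by rewrite spec.unlock rq_conj rq_rdiag. Qed.

Lemma spec_mul m n p (U : 'M[C]_(m, n)) d (W : 'M[C]_(n, p)) :
  W^t* *m spec U d *m W = spec (U *m W) d.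
Proof. by rewrite spec.unlock adjM !mulmxA. Qed.

Lemma unitary_adj n (U : 'M[C]_n) : U \is unitarymx -> U^t* *m U = 1%:M.
Proof. by move/unitarymxP => h; exact: mulmx1C. Qed.

Lemma rdiagM n (a b : 'rV[R]_n) :
  rdiag a *m rdiag b = rdiag (\row_i (a 0 i * b 0 i)).
Proof.
rewrite rdiag.unlock mulmx_diag; congr diag_mx; apply/rowP => i.
by rewrite !mxE rmorphM.
Qed.

Lemma specM n (U : 'M[C]_n) a b : U \is unitarymx ->
  spec U a *m spec U b = spec U (\row_i (a 0 i * b 0 i)).
Proof.
move=> /unitarymxP uU; rewrite spec.unlock !mulmxA -(mulmxA _ U) uU mulmx1.
by rewrite -(mulmxA _ (rdiag a)) rdiagM.
Qed.

Lemma spec_const n (U : 'M[C]_n) c : U \is unitarymx ->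
  spec U (const_mx c) = (rc c)%:M.
Proof.
move=> uU; rewrite spec.unlock rdiag_const -mulmxA mul_scalar_mx -scalemxAr.
by rewrite unitary_adj// scalemx1.
Qed.

Lemma spec_unit n (U : 'M[C]_n) : U \is unitarymx -> spec U (const_mx 1) = 1%:M.
Proof. exact: spec_const. Qed.

Lemma specZ m n (U : 'M[C]_(m, n)) c d : rc c *: spec U d = spec U (c *: d).
Proof.
apply/matrixP => i j; rewrite mxE !specE mulr_sumr; apply: eq_bigr => l _.
by rewrite mxE rmorphM /=; ring.
Qed.

Lemma spec1 n (d : 'rV[R]_n) : spec 1%:M d = rdiag d.
Proof. by rewrite spec.unlock mulmx1 trmx1 map_mx1 mul1mx. Qed.

Lemma unitary1 n : (1%:M : 'M[C]_n) \is unitarymx.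
Proof. by apply/unitarymxP; rewrite trmx1 map_mx1 mul1mx. Qed.

Lemma eigvals_perm n (A : 'M[C]_n) : exists s : 'S_n,
  forall i, eigvals A 0 i = re (spectral_diag A 0 (s i)).
Proof.
pose t := mktuple (fun j => re (spectral_diag A 0 j)).
have st : size (sort >=%O t) == n by rewrite size_sort size_tuple.
have /tuple_permP[s hs] : perm_eq (Tuple st) t by rewrite perm_sort.
exists s => i; rewrite mxE.
have := congr1 (fun x : seq R => x`_i) hs; rewrite /= => ->.
by rewrite (nth_map i) ?size_enum_ord// nth_ord_enum tnth_mktuple.
Qed.

Lemma eigvals_sorted n (A : 'M[C]_n) (i j : 'I_n) : (i <= j)%N ->
  eigvals A 0 j <= eigvals A 0 i.
Proof.
move=> ij; rewrite !mxE; set s := sort _ _.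
have ss : sorted >=%O s by apply: sort_sorted => x y; exact: le_total.
have sz : size s = n by rewrite size_sort size_map size_enum_ord.
apply: (@sorted_leq_nth _ >=%O _ _ 0 s ss i j) => //.
- by move=> x y z /= h h'; exact: le_trans h' h.
- by move=> x /=.
- by rewrite inE sz.
- by rewrite inE sz.
Qed.

Lemma herm_spectral n (A : 'M[C]_n) : herm A ->
  A = spec (spectralmx A) (map_mx re (spectral_diag A)).
Proof.
move=> hA; have hA' : A \is hermsymmx by apply/hermsymmxP.
rewrite {1}(orthomx_spectralP (hermitian_normalmx hA')).
rewrite (invmx_unitary (spectral_unitarymx A)) spec.unlock rdiag.unlock.
congr (_ *m diag_mx _ *m _); apply/rowP => i; rewrite !mxE.
apply: conj_fix_rc; apply/CrealP.
by have /mxOverP := hermitian_spectral_diag_real hA'; apply.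
Qed.

(** The permutation that sorts the eigenvalues is absorbed into the unitary factor. *)
Lemma herm_spec_eigvals n (A : 'M[C]_n) : herm A ->
  exists2 U : 'M[C]_n, U \is unitarymx & A = spec U (eigvals A).
Proof.
move=> hA; have [s hs] := eigvals_perm A.
exists (perm_mx s *m spectralmx A).
  apply: mul_unitarymx; last exact: spectral_unitarymx.
  apply/unitarymxP; rewrite tr_perm_mx map_perm_mx -perm_mxM.
  by rewrite mulgV perm_mx1.
rewrite {1}(herm_spectral hA) -row_permE; apply/matrixP => i j; rewrite !specE.
rewrite (reindex_inj (@perm_inj _ s)); apply: eq_bigr => l _.
by rewrite !mxE -hs mxE.
Qed.

(* In eigenbases of [A] and [B] the relation [A W = W B] says that each entry
   of [W] vanishes or relates equal eigenvalues. *)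
Lemma spec_intertwine n (U V W : 'M[C]_n) a b (f : R -> R) :
  U \is unitarymx -> V \is unitarymx ->
  spec U a *m W = W *m spec V b ->
  spec U (map_mx f a) *m W = W *m spec V (map_mx f b).
Proof.
move=> uU uV h; have uUa := unitary_adj uU; have uVa := unitary_adj uV.
move/unitarymxP: (uU) => uU'; move/unitarymxP: (uV) => uV'.
pose Z := U *m W *m V^t*.
have WE : W = U^t* *m Z *m V.
  by rewrite /Z !mulmxA uUa mul1mx -!mulmxA uVa mulmx1.
have E a' b' : spec U a' *m W = U^t* *m (rdiag a' *m Z) *m V /\
    W *m spec V b' = U^t* *m (Z *m rdiag b') *m V.
  split; first by rewrite spec.unlock /Z !mulmxA -(mulmxA _ (V^t*) V) uVa mulmx1.
  by rewrite {1}WE spec.unlock !mulmxA -(mulmxA _ V (V^t*)) uV' mulmx1.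
have [E1 E2] := E a b; have {E} [-> ->] := E (map_mx f a) (map_mx f b).
congr (_ *m _ *m _).
have {}h : rdiag a *m Z = Z *m rdiag b.
  have : U *m (spec U a *m W) *m V^t* = U *m (W *m spec V b) *m V^t* by rewrite h.
  rewrite E1 E2 !mulmxA uU' !mul1mx -!mulmxA uV' !mulmx1 //.
clearbody Z; apply/matrixP => i j; have /matrixP/(_ i j) := h.
rewrite rdiag.unlock !mul_diag_mx !mul_mx_diag !mxE [Z i j * _]mulrC.
move=> /eqP; rewrite -subr_eq0 -mulrBl mulf_eq0 => /orP[|/eqP->]; last first.
  by rewrite mulr0 mul0r.
by rewrite subr_eq0 => /eqP/(congr1 re); rewrite !rcK => ->; rewrite mulrC.
Qed.

(** The functional calculus is defined by one chosen diagonalization; intertwining with [W = 1]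
    shows that any other one gives the same matrix. *)
Lemma mxfun_spec n (U : 'M[C]_n) d f : U \is unitarymx ->
  mxfun f (spec U d) = spec U (map_mx f d).
Proof.
move=> uU; set A := spec U d.
have hA : herm A := herm_spec U d.
have uP := spectral_unitarymx A.
have -> : mxfun f A = spec (spectralmx A) (map_mx f (map_mx re (spectral_diag A))).
  rewrite /mxfun (invmx_unitary uP) spec.unlock rdiag.unlock; congr (_ *m diag_mx _ *m _).
  by apply/rowP => i; rewrite !mxE.
rewrite -[LHS]mulmx1 -[RHS]mul1mx; apply: spec_intertwine => //.
by rewrite -herm_spectral// mulmx1 mul1mx.
Qed.

Lemma mxpow_spec n (U : 'M[C]_n) d t : U \is unitarymx ->
  mpw (spec U d) t = spec U (map_mx (fun x => x `^ t) d).
Proof. by rewrite mpw.unlock; exact: mxfun_spec. Qed.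

Lemma mxfun_intertwine n (A B W : 'M[C]_n) f : herm A -> herm B ->
  A *m W = W *m B -> mxfun f A *m W = W *m mxfun f B.
Proof.
move=> /herm_spec_eigvals[U uU ->] /herm_spec_eigvals[V uV ->] h.
by rewrite !mxfun_spec//; exact: spec_intertwine.
Qed.

Lemma posdef_spec n (U : 'M[C]_n) (d : 'rV[R]_n) : U \is unitarymx -> (forall i, 0 < d 0 i) ->
  pd (spec U d).
Proof.
move=> uU d0; apply/posdefP; split=> [|v v0]; first exact: herm_spec.
have Uv0 : U *m v != 0.
  apply: contra v0 => /eqP Uv; apply/eqP.
  by rewrite -[v]mul1mx -(unitary_adj uU) -mulmxA Uv mulmx0.
rewrite rq_spec; have := nrm2_gt0 Uv0.
rewrite nrm2.unlock !lt_neqAle => /andP[nz _]; apply/andP; split; last first.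
  by apply: sumr_ge0 => i _; rewrite mulr_ge0 ?sq_ge0// ltW.
apply: contra nz; rewrite eq_sym => /eqP /psumr_eq0P h; apply/eqP/esym/big1 => i _.
apply/eqP; have /eqP := h (fun j _ => mulr_ge0 (ltW (d0 j)) (sq_ge0 _)) i isT.
by rewrite mulf_eq0 gt_eqF.
Qed.

Lemma posdef_spec_eigvals n (A : 'M[C]_n) : pd A ->
  exists U : 'M[C]_n, [/\ U \is unitarymx, A = spec U (eigvals A) &
    forall i, 0 < eigvals A 0 i].
Proof.
move=> pA; have [U uU AE] := herm_spec_eigvals (posdef_herm pA).
by exists U; split=> // i; apply: eigvals_gt0; rewrite pd.unlock in pA.
Qed.

Lemma posdef_specP n (A : 'M[C]_n) : pd A ->
  exists (U : 'M[C]_n) (d : 'rV[R]_n), [/\ U \is unitarymx, A = spec U d & forall i, 0 < d 0 i].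
Proof.
move=> /posdef_spec_eigvals[U [uU AE d0]].
by exists U, (eigvals A).
Qed.

Lemma posdef_mxpow n (A : 'M[C]_n) t : pd A -> pd (mpw A t).
Proof.
move=> /posdef_specP[U [d [uU -> d0]]]; rewrite mxpow_spec//.
by apply: posdef_spec => // i; rewrite mxE powR_gt0.
Qed.

Lemma mxpowD n (A : 'M[C]_n) s t : pd A ->
  mpw A s *m mpw A t = mpw A (s + t).
Proof.
move=> /posdef_specP[U [d [uU -> d0]]]; rewrite !mxpow_spec// specM//.
congr spec; apply/rowP => i; rewrite !mxE powRD//.
by apply/implyP => _; rewrite gt_eqF.
Qed.

Lemma mxpow1 n (A : 'M[C]_n) : pd A -> mpw A 1 = A.
Proof.
move=> /posdef_specP[U [d [uU -> d0]]]; rewrite !mxpow_spec//.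
congr spec; apply/rowP => i; rewrite mxE powRr1// ltW//.
Qed.

Lemma mxpow0 n (A : 'M[C]_n) : pd A -> mpw A 0 = 1%:M.
Proof.
move=> /posdef_specP[U [d [uU -> d0]]]; rewrite !mxpow_spec// -(spec_unit uU).
by congr spec; apply/rowP => i; rewrite !mxE powRr0.
Qed.

Lemma mxpowZ n (A : 'M[C]_n) c t : 0 <= c -> pd A ->
  mpw (rc c *: A) t = rc (c `^ t) *: mpw A t.
Proof.
move=> c0 /posdef_specP[U [d [uU -> d0]]]; rewrite specZ !mxpow_spec// specZ.
congr spec; by apply/rowP => i; rewrite !mxE powRM// ltW.
Qed.

Lemma mxpow_rdiag n (d : 'rV[R]_n) t :
  mpw (rdiag d) t = rdiag (map_mx (fun x => x `^ t) d).
Proof. by rewrite -!spec1 mxpow_spec// unitary1. Qed.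

Lemma mxpowM n (A : 'M[C]_n) s t : pd A -> mpw (mpw A s) t = mpw A (s * t).
Proof.
move=> /posdef_specP[U [d [uU -> d0]]]; rewrite !mxpow_spec//.
by congr spec; apply/rowP => i; rewrite !mxE powRrM.
Qed.

Lemma mxpowN n (A : 'M[C]_n) t : pd A -> mpw A (- t) *m mpw A t = 1%:M.
Proof. by move=> pA; rewrite mxpowD// addNr mxpow0. Qed.

Lemma mxpowNr n (A : 'M[C]_n) t : pd A -> mpw A t *m mpw A (- t) = 1%:M.
Proof. by move=> pA; rewrite mxpowD// subrr mxpow0. Qed.

Lemma mxpow_half n (A : 'M[C]_n) : pd A -> mpw A 2^-1 *m mpw A 2^-1 = A.
Proof.
move=> pA; rewrite mxpowD// (_ : 2^-1 + 2^-1 = 1 :> R) ?mxpow1//.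
by lra.
Qed.

Lemma herm_mxpow n (A : 'M[C]_n) t : pd A -> herm (mpw A t).
Proof. by move=> pA; exact/posdef_herm/posdef_mxpow. Qed.

Lemma posdef_conj m n (A : 'M[C]_m) (W : 'M[C]_(m, n)) (V : 'M[C]_(n, m)) :
  V *m W = 1%:M -> pd A -> pd (W^t* *m A *m W).
Proof.
move=> VW /posdefP[hA pA]; apply/posdefP; split; first exact: herm_conj.
move=> v v0; rewrite rq_conj pA//; apply: contra v0 => /eqP Wv.
by rewrite -[v]mul1mx -VW -mulmxA Wv mulmx0.
Qed.

Lemma posdef_sandwich n (A W V : 'M[C]_n) : herm W -> V *m W = 1%:M ->
  pd A -> pd (W *m A *m W).
Proof. by move=> hW VW pA; rewrite -{1}(hermK hW); exact: posdef_conj VW pA. Qed.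

Lemma posdefZ n c (A : 'M[C]_n) : 0 < c -> pd A -> pd (rc c *: A).
Proof.
move=> c0 /posdefP[hA pA]; apply/posdefP; split; first exact: hermZ.
by move=> v v0; rewrite rqZ mulr_gt0// pA.
Qed.

Lemma posdef_scalar n c : 0 < c -> pd ((rc c)%:M : 'M[C]_n).
Proof.
move=> c0; rewrite -rdiag_const -spec1; apply: posdef_spec => [|i].
  exact: unitary1.
by rewrite mxE.
Qed.

End spectral.

(** * The Loewner-Heinz inequality *)

Section monotone.
Context {R : realType}.
Local Notation C := (Cx R).

Lemma rq_eigenl n (D Q : 'M[C]_n) v c : herm D -> D *m v = rc c *: v ->
  rq (D *m Q) v = c * rq Q v.
Proof.
move=> hD Dv; rewrite !rq.unlock /qform !mulmxA -{1}(hermK hD) -adjM Dv.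
by rewrite [(_ *: _)^T]linearZ /= map_mxZ /= conj_rc -!scalemxAl mx00Z re_rcM.
Qed.

Lemma rq_eigenr n (D Q : 'M[C]_n) v c : D *m v = rc c *: v ->
  rq (Q *m D) v = c * rq Q v.
Proof.
move=> Dv; rewrite !rq.unlock /qform !mulmxA -(mulmxA _ D v) Dv.
by rewrite -scalemxAr mx00Z re_rcM.
Qed.

(* If [(Q - P) v = d v] then [<(Q^2 - P^2) v, v> = d <(P + Q) v, v>], so a
   negative eigenvalue [d] is excluded. *)
Lemma sqr_lel n (P Q : 'M[C]_n) : pd P -> pd Q ->
  lel (P *m P) (Q *m Q) -> lel P Q.
Proof.
move=> pP pQ PQ; have hP := posdef_herm pP; have hQ := posdef_herm pQ.
have hD : herm (Q - P) by apply: hermD => //; exact: hermN.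
have [U uU DE] := herm_spec_eigvals hD; set d := eigvals _ in DE.
suff d0 i : 0 <= d 0 i.
  move=> v; rewrite -subr_ge0 -rqB DE rq_spec; apply: sumr_ge0 => i _.
  by rewrite mulr_ge0 ?sq_ge0.
rewrite leNgt; apply/negP => di0.
pose v : 'cV[C]_n := U^t* *m delta_mx i 0.
have Uv : U *m v = delta_mx i 0 by rewrite mulmxA (unitarymxP uU) mul1mx.
have v0 : v != 0.
  apply/eqP => v0; move: Uv; rewrite v0 mulmx0 => /matrixP /(_ i 0).
  by rewrite !mxE !eqxx => /eqP; rewrite eq_sym oner_eq0.
have Dv : (Q - P) *m v = rc (d 0 i) *: v.
  rewrite DE spec.unlock -mulmxA Uv -mulmxA scalemxAr; congr (_ *m _).
  apply/colP => j; rewrite rdiag.unlock mul_diag_mx !mxE andbT.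
  by case: eqVneq => [->//|_]; rewrite !mulr0.
have QP : Q *m Q - P *m P = (Q - P) *m Q + P *m (Q - P).
  by rewrite mulmxBl mulmxBr addrA subrK.
have := PQ v; rewrite -subr_ge0 -rqB QP rqD (rq_eigenl _ hD Dv) (rq_eigenr _ Dv).
rewrite -mulrDr nmulr_rge0// leNgt => /negP; apply.
by apply: addr_gt0; exact: posdef_rq.
Qed.

(** Expanding [(A' - B') A (A' - B') >= 0] gives [A' - 2 B' + B' A B' >= 0], and
    [B' A B' <= B' B B' = B']. *)
Lemma inv_lel n (A B A' B' : 'M[C]_n) : pd A -> herm A' -> herm B' ->
  A *m A' = 1%:M -> B *m B' = 1%:M -> lel A B -> lel B' A'.
Proof.
move=> pA hA' hB' AA' BB' AB w; have A'A := mulmx1C AA'; have B'B := mulmx1C BB'.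
have hD : herm (A' - B') by apply: hermD => //; exact: hermN.
have := posdef_rq_ge0 ((A' - B') *m w) pA.
rewrite -rq_sandwich//.
have -> : (A' - B') *m A *m (A' - B') = A' - B' - B' + B' *m A *m B'.
  rewrite mulmxBl A'A mulmxBl mul1mx mulmxBr -(mulmxA _ A A') AA' mulmx1.
  by rewrite opprB addrA addrAC.
have := AB (B' *m w); rewrite -!rq_sandwich// B'B mul1mx.
rewrite !(rqD, rqN); lra.
Qed.

(** After a sandwich by [K = A^(-s/2)] it suffices to compare squares. The square on the left is
    [K A^t K]; the one on the right is [K (B^m A^(-s) B^m) K], which dominates [K B^t K] because
    inversion reverses the hypothesis on the exponent [s]. *)
Lemma mxpow_lel_midpoint n (A B : 'M[C]_n) s t : pd A -> pd B ->
  lel (mpw A s) (mpw B s) -> lel (mpw A t) (mpw B t) ->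
  lel (mpw A ((s + t) / 2)) (mpw B ((s + t) / 2)).
Proof.
move=> pA pB hs ht; set m := (s + t) / 2.
pose K := mpw A (- (s / 2)); pose L := mpw A (s / 2).
have hK : herm K by exact: herm_mxpow.
have hL : herm L by exact: herm_mxpow.
have LK : L *m K = 1%:M by exact: mxpowNr.
have KL := mulmx1C LK.
have KK : K *m K = mpw A (- s) by rewrite /K mxpowD//; congr (mpw _ _); field.
clearbody K L.
have E M : M = L *m (K *m M *m K) *m L.
  by rewrite !mulmxA LK mul1mx -mulmxA KL mulmx1.
rewrite [X in lel X _]E [X in lel _ X]E; apply: lel_sandwich => //.
apply: sqr_lel.
- exact: (posdef_sandwich hK LK (posdef_mxpow m pA)).
- exact: (posdef_sandwich hK LK (posdef_mxpow m pB)).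
have S M : K *m M *m K *m (K *m M *m K) = K *m (M *m mpw A (- s) *m M) *m K.
  by rewrite -KK !mulmxA.
rewrite !S; apply: lel_sandwich => //.
have -> : mpw A m *m mpw A (- s) *m mpw A m = mpw A t.
  by rewrite !mxpowD//; congr (mpw _ _); rewrite /m; field.
apply: (lel_trans ht).
have -> : mpw B t = mpw B m *m mpw B (- s) *m mpw B m.
  by rewrite !mxpowD//; congr (mpw _ _); rewrite /m; field.
apply: lel_sandwich; first exact: herm_mxpow.
by apply: (inv_lel (posdef_mxpow s pA) _ _ _ _ hs);
  rewrite ?mxpowNr//; exact: herm_mxpow.
Qed.

Lemma mxpow_lel_dyadic n (A B : 'M[C]_n) : pd A -> pd B -> lel A B ->
  forall p k, (k <= 2 ^ p)%N -> lel (mpw A (k%:R / 2 ^+ p)) (mpw B (k%:R / 2 ^+ p)).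
Proof.
move=> pA pB AB; elim=> [|p IH] k kp.
  rewrite expr0 divr1; case: k kp => [|[|//]] _; first by rewrite !mxpow0.
  by rewrite !mxpow1.
(* A dyadic of level [p.+1] is the midpoint of two of level [p], whose numerators are [k / 2]
   rounded down and up. *)
have -> : k%:R / 2 ^+ p.+1 = ((k./2)%:R / 2 ^+ p + (uphalf k)%:R / 2 ^+ p) / 2 :> R.
  rewrite -{1}(odd_double_half k) uphalf_half -addnn !natrD exprS.
  have : (2 ^+ p : R) != 0 by rewrite expf_neq0.
  by move=> h; field.
have kp' : (uphalf k <= 2 ^ p)%N by rewrite leq_uphalf_double -mul2n -expnS.
apply: mxpow_lel_midpoint => //; apply: IH => //.
by rewrite (leq_trans _ kp')// uphalf_half leq_addl.
Qed.

Lemma rq_mxpow_cvg n (A : 'M[C]_n) v (u : R^nat) (s : R) : pd A ->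
  u @ \oo --> s -> rq (mpw A (u i)) v @[i --> \oo] --> rq (mpw A s) v.
Proof.
move=> /posdef_specP[U [d [uU -> d0]]] us; rewrite mxpow_spec// rq_spec.
under eq_fun do rewrite mxpow_spec// rq_spec.
apply: cvg_big => [|i _]; first exact: add_continuous.
apply: cvgMr_tmp; rewrite mxE; under eq_fun do rewrite mxE.
rewrite /powR gt_eqF//.
apply: (@continuous_cvg _ _ _ _ _ (fun i0 => u i0 * ln (d 0 i)) expR).
  exact: continuous_expR.
exact: cvgMr_tmp.
Qed.

(* Loewner-Heinz: the exponents for which it holds are closed under midpoints
   and limits. *)
Lemma mxpow_lel n (A B : 'M[C]_n) s : pd A -> pd B -> 0 <= s <= 1 ->
  lel A B -> lel (mpw A s) (mpw B s).
Proof.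
move=> pA pB /andP[s0 s1] AB v.
(* Dyadic truncations of [s] from below, with error at most [2 ^ (- p)]. *)
pose u p : R := (Num.truncn (s * 2 ^+ p))%:R / 2 ^+ p.
have p0 p : 0 < 2 ^+ p :> R by rewrite exprn_gt0.
have tr p := truncn_itv (mulr_ge0 s0 (ltW (p0 p))).
have us : u @ \oo --> s.
  apply: (@squeeze_cvgr _ _ _ _ (fun p => s - geometric 1 2^-1 p) (cst s)).
  - near=> p; have /andP[t1 t2] := tr p; rewrite /u /geometric /= ler_pdivrMr//.
    rewrite t1 andbT ler_pdivlMr// mulrBl mul1r -exprMn mulVf// expr1n.
    by rewrite lerBlDr natr1 ltW.
  - rewrite -[X in _ --> X]subr0; apply: cvgB; first exact: cvg_cst.
    by apply: cvg_geometric; rewrite ger0_norm// invf_lt1// ltr1n.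
  - exact: cvg_cst.
apply: (ler_cvg_to (rq_mxpow_cvg (v := v) pA us) (rq_mxpow_cvg pB us)).
near=> p; apply: mxpow_lel_dyadic => //.
rewrite -(ler_nat R) natrX; have /andP[t1 _] := tr p.
by apply: (le_trans t1); rewrite ler_piMl// ltW.
Unshelve. all: by end_near. Qed.

End monotone.

(** * Weighted geometric means *)

HB.lock Definition wgm {R : realType} {n} (r : R) (X A : 'M[Cx R]_n) :=
  mpw X 2^-1 *m mpw (mpw X (- 2^-1) *m A *m mpw X (- 2^-1)) r *m mpw X 2^-1.

Section wgm.
Context {R : realType}.
Local Notation C := (Cx R).

Lemma wgeomeanE n r (X A : 'M[C]_n) : wgeomean r X A = wgm r X A.
Proof. by rewrite wgm.unlock mpw.unlock. Qed.

Lemma pd_sandwich_half n (X A : 'M[C]_n) t : pd X -> pd A ->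
  pd (mpw X t *m A *m mpw X t).
Proof.
move=> pX pA; apply: (posdef_sandwich _ (mxpowN t pX) pA); exact: herm_mxpow.
Qed.

Lemma pd_wgm n r (X A : 'M[C]_n) : pd X -> pd A -> pd (wgm r X A).
Proof.
move=> pX pA; rewrite wgm.unlock; apply: pd_sandwich_half => //.
by apply: posdef_mxpow; exact: pd_sandwich_half.
Qed.

Lemma wgm_lel_r n r (X A B : 'M[C]_n) : 0 <= r <= 1 -> pd X -> pd A -> pd B ->
  lel A B -> lel (wgm r X A) (wgm r X B).
Proof.
move=> r01 pX pA pB AB; rewrite wgm.unlock; apply: lel_sandwich.
  exact: herm_mxpow.
apply: mxpow_lel => //; try exact: pd_sandwich_half.
by apply: lel_sandwich => //; exact: herm_mxpow.
Qed.

Lemma mxpow_inv n (E F : 'M[C]_n) t : pd E -> F *m E = 1%:M -> mpw F t = mpw E (- t).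
Proof.
move=> pE FE; have -> : F = mpw E (- 1).
  by rewrite -[F]mulmx1 -(mxpowNr 1 pE) mxpow1// mulmxA FE mul1mx.
by rewrite mxpowM// mulN1r.
Qed.

Lemma mxpow_intertwine n (A B W : 'M[C]_n) t : pd A -> pd B ->
  A *m W = W *m B -> mpw A t *m W = W *m mpw B t.
Proof.
move=> pA pB; rewrite mpw.unlock; apply: mxfun_intertwine; exact: posdef_herm.
Qed.

(* With [Z = A^(1/2) X^(-1/2)], both sides are expressed through the functional
   calculi of [Z^* Z] and [Z Z^*], which [Z] intertwines. *)
Lemma wgm_swap n r (X A : 'M[C]_n) : pd X -> pd A -> wgm r X A = wgm (1 - r) A X.
Proof.
move=> pX pA; rewrite wgm.unlock.
have pB := pd_sandwich_half (- 2^-1) pX pA.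
have pF := pd_sandwich_half (- 2^-1) pA pX.
have pXi : pd (mpw X (- 1)) by exact: posdef_mxpow.
have pE := pd_sandwich_half 2^-1 pA pXi.
have hX1 := mxpowNr 2^-1 pX; have hX2 := mxpowN 2^-1 pX.
have hA1 := mxpowNr 2^-1 pA; have hA2 := mxpowN 2^-1 pA.
have hA := mxpow_half pA; have hX := mxpow_half pX.
have hXi : mpw X (- 2^-1) *m mpw X (- 2^-1) = mpw X (- 1).
  by rewrite mxpowD//; congr (mpw _ _); lra.
have XXi : X *m mpw X (- 1) = 1%:M by rewrite -[X in X *m _](mxpow1 pX) mxpowNr.
move: pB pF pE hX1 hX2 hA1 hA2 hA hX hXi XXi; clear pXi.
move: (mpw X (- 1)) (mpw X 2^-1) (mpw X (- 2^-1)) (mpw A 2^-1) (mpw A (- 2^-1)).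
move=> Xi H Hi K Ki pB pF pE hX1 hX2 hA1 hA2 hA hX hXi XXi.
(* The core of the swapped mean is the inverse of [E = Z Z^*], so its power of exponent [1 - r] is
   the power [r - 1] of [E]. *)
have FE : (Ki *m X *m Ki) *m (K *m Xi *m K) = 1%:M.
  by rewrite !mulmxA -(mulmxA _ Ki K) hA2 mulmx1 -(mulmxA _ X Xi) XXi mulmx1.
rewrite (mxpow_inv _ pE FE) opprB.
set B := Hi *m A *m Hi in pB *; set E := K *m Xi *m K in pE FE *.
have EZ : E *m (K *m Hi) = (K *m Hi) *m B.
  by rewrite /E /B -hXi -hA !mulmxA.
have := mxpow_intertwine (r - 1) pE pB EZ.
have BB : B *m mpw B (r - 1) = mpw B r.
  by rewrite -{1}(mxpow1 pB) mxpowD//; congr (mpw _ _); lra.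
have KH : K *m K *m Hi = H *m B by rewrite hA /B !mulmxA hX1 mul1mx.
move=> I; have -> : K *m mpw E (r - 1) *m K = K *m (mpw E (r - 1) *m (K *m Hi)) *m H.
  by rewrite -!mulmxA hX2 mulmx1.
by rewrite I !mulmxA KH -(mulmxA H B) BB.
Qed.

Lemma wgm_lel_l n r (X Y A : 'M[C]_n) : 0 <= r <= 1 -> pd X -> pd Y -> pd A ->
  lel X Y -> lel (wgm r X A) (wgm r Y A).
Proof.
move=> r01 pX pY pA XY; rewrite !(wgm_swap r)//; apply: wgm_lel_r => //; lra.
Qed.

Lemma wgmZr n r c (X A : 'M[C]_n) : 0 < c -> pd X -> pd A ->
  wgm r X (rc c *: A) = rc (c `^ r) *: wgm r X A.
Proof.
move=> c0 pX pA; rewrite wgm.unlock -scalemxAr -scalemxAl.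
rewrite mxpowZ ?ltW//; last exact: pd_sandwich_half.
by rewrite -scalemxAr -scalemxAl.
Qed.

Lemma wgmZl n r c (X A : 'M[C]_n) : 0 < c -> pd X -> pd A ->
  wgm r (rc c *: X) A = rc (c `^ (1 - r)) *: wgm r X A.
Proof.
move=> c0 pX pA; rewrite !(wgm_swap r)//; last exact: posdefZ.
exact: wgmZr.
Qed.

Lemma mxpow_1 n t : mpw (1%:M : 'M[C]_n) t = 1%:M.
Proof.
rewrite -[in LHS](spec_unit (unitary1 n)) mxpow_spec ?unitary1//.
rewrite -[RHS](spec_unit (unitary1 n)); congr spec.
by apply/rowP => i; rewrite !mxE powR1.
Qed.

Lemma wgm_id n r (X : 'M[C]_n) : pd X -> wgm r X X = X.
Proof.
move=> pX; rewrite wgm.unlock.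
have -> : mpw X (- 2^-1) *m X *m mpw X (- 2^-1) = 1%:M.
  rewrite -[Y in _ *m Y *m _](mxpow_half pX) !mulmxA mxpowN// mul1mx.
  by rewrite mxpowNr.
by rewrite mxpow_1 mulmx1 mxpow_half.
Qed.

Lemma wgm_rdiag n r (x a : 'rV[R]_n) : (forall i, 0 < x 0 i) -> (forall i, 0 < a 0 i) ->
  wgm r (rdiag x) (rdiag a) = rdiag (\row_i (x 0 i `^ (1 - r) * a 0 i `^ r)).
Proof.
move=> x0 a0; rewrite wgm.unlock !mxpow_rdiag !rdiagM mxpow_rdiag !rdiagM.
congr rdiag; apply/rowP => i; rewrite !mxE.
rewrite !powRM ?powR_ge0//; last by rewrite mulr_ge0 ?powR_ge0 ?ltW.
  rewrite -!powRrM.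
  have e (s t : R) : x 0 i `^ s * x 0 i `^ t = x 0 i `^ (s + t).
    by rewrite powRD//; apply/implyP => _; rewrite gt_eqF.
  set p := a 0 i `^ r.
  transitivity (x 0 i `^ 2^-1 * x 0 i `^ (- 2^-1 * r) * x 0 i `^ (- 2^-1 * r) *
    x 0 i `^ 2^-1 * p); first by ring.
  by rewrite !e; congr (_ `^ _ * _); lra.
exact: ltW.
Qed.

End wgm.

(** * Log-majorization and weak majorization of sequences *)

Section scalar.
Context {R : realType}.

(* [1 + u <= exp u] at [u = - a] and [u = ln z - a], where [a = r ln z]. *)
Lemma powR_le_affine (z r : R) : 0 < z -> 0 <= r <= 1 -> z `^ r <= 1 - r + r * z.
Proof.
move=> z0 r01; rewrite /powR gt_eqF//; set a := r * ln z.
have h1 := expR_ge1Dx (- a); have h2 := expR_ge1Dx (ln z - a).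
have E1 : expR (- a) * expR a = 1 by rewrite -expRD addNr expR0.
have E2 : expR (ln z - a) * expR a = z by rewrite -expRD subrK lnK.
have ea := expR_gt0 a.
rewrite -[leRHS](_ : (((1 - r) * expR (- a) + r * expR (ln z - a)) * expR a) = _); last first.
  by rewrite mulrDl -!mulrA E1 E2 mulr1.
rewrite -[leLHS]mul1r ler_pM2r//.
rewrite [leLHS](_ : 1 = (1 - r) * (1 - a) + r * (1 + (ln z - a))); last first.
  by rewrite /a; ring.
by apply: lerD; apply: ler_wpM2l => //; lra.
Qed.

(** The tangent bound [powR_le_affine] at [d / x], scaled by [x]. *)
Lemma powR_young (x d r : R) : 0 < x -> 0 < d -> 0 <= r <= 1 ->
  x `^ (1 - r) * d `^ r <= (1 - r) * x + r * d.
Proof.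
move=> x0 d0 r01; have z0 : 0 < d / x by rewrite divr_gt0.
have := powR_le_affine z0 r01; rewrite -(ler_pM2l x0).
have -> : x * (d / x) `^ r = x `^ (1 - r) * d `^ r.
  rewrite -[Y in _ = _ * Y `^ _](divfK (lt0r_neq0 x0)) [in RHS]powRM ?ltW// [RHS]mulrA [RHS]mulrAC -powRD.
    by rewrite subrK powRr1 ?ltW.
  by apply/implyP => _; rewrite gt_eqF.
move=> h; apply: (le_trans h); rewrite le_eqVlt; apply/orP; left; apply/eqP; field; exact: lt0r_neq0.
Qed.

Lemma jensen_powR (I : finType) (w p : I -> R) (r : R) : 0 <= r <= 1 ->
  (forall i, 0 <= w i) -> (forall i, 0 < p i) -> 0 < \sum_i w i ->
  \sum_i w i * p i `^ r <= (\sum_i w i) `^ (1 - r) * (\sum_i w i * p i) `^ r.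
Proof.
move=> r01 w0 p0 W0; set W := \sum_i w i in W0 *; set P := \sum_i w i * p i.
have P0 : 0 < P.
  have P0 : 0 <= P by apply: sumr_ge0 => i _; rewrite mulr_ge0// ltW.
  rewrite lt_neqAle P0 andbT eq_sym; apply/eqP => /psumr_eq0P h.
  move: W0; rewrite /W big1 ?ltxx// => i _; apply/eqP.
  have /eqP := h (fun j _ => mulr_ge0 (w0 j) (ltW (p0 j))) i isT.
  by rewrite mulf_eq0 (gt_eqF (p0 i)) orbF.
have c0 : 0 < P / W by rewrite divr_gt0.
have -> : W `^ (1 - r) * P `^ r = W * (P / W) `^ r.
  rewrite -[Y in _ * Y `^ _ = _](divfK (lt0r_neq0 W0)) [in LHS]powRM ?ltW// [LHS]mulrA [LHS]mulrAC -powRD.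
    by rewrite subrK powRr1 ?ltW.
  by apply/implyP => _; rewrite gt_eqF.
(* The graph of the power lies below its tangent at the weighted mean [P / W]; summing the tangent
   values gives equality. *)
have h i : w i * p i `^ r <= w i * ((1 - r + r * (p i / (P / W))) * (P / W) `^ r).
  apply: ler_wpM2l => //.
  rewrite -{1}[p i](divfK (lt0r_neq0 c0)) (powRM _ (ltW (divr_gt0 (p0 i) c0)) (ltW c0)).
  apply: ler_wpM2r; first exact: powR_ge0.
  by apply: powR_le_affine => //; rewrite divr_gt0.
apply: (le_trans (ler_sum _ (fun i _ => h i))).
rewrite le_eqVlt; apply/orP; left; apply/eqP; set t := _ `^ r.
transitivity (\sum_i (w i * (1 - r) * t + (w i * p i) * (r / (P / W) * t))).
  by apply: eq_bigr => i _; ring.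
rewrite big_split /= -!mulr_suml -/P -/W; field.
by rewrite !gt_eqF.
Qed.

Lemma big_lt_recr (S : Type) (idx : S) (op : Monoid.com_law idx) N k (kN : (k < N)%N)
  (F : 'I_N -> S) : \big[op/idx]_(i < N | (i < k.+1)%N) F i =
  op (\big[op/idx]_(i < N | (i < k)%N) F i) (F (Ordinal kN)).
Proof.
rewrite (bigD1 (Ordinal kN))//= Monoid.mulmC; congr (op _ _).
apply: eq_bigl => i; rewrite ltnS -(inj_eq val_inj) /= (ltn_neqAle i k).
by rewrite andbC.
Qed.

(** With [a i = ln (z i / y i)], the inequality [1 + u <= exp u] gives [y i * a i <= z i - y i]. The
    partial sums of [a] are nonnegative by hypothesis, and Abel summation against the decreasing
    weights [y] preserves this. *)
Lemma logmaj_weakmaj N (y z : 'I_N -> R) K :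
  (forall i, 0 < y i) -> (forall i, 0 < z i) ->
  (forall i j : 'I_N, (i <= j)%N -> y j <= y i) ->
  (forall k, (k <= N)%N ->
    \prod_(i < N | (i < k)%N) y i <= \prod_(i < N | (i < k)%N) z i) ->
  (K <= N)%N ->
  \sum_(i < N | (i < K)%N) y i <= \sum_(i < N | (i < K)%N) z i.
Proof.
move=> y0 z0 ydec yz KN.
pose a i := ln (z i) - ln (y i).
pose S k := \sum_(i < N | (i < k)%N) a i.
have S0 k : (k <= N)%N -> 0 <= S k.
  move=> kN; rewrite /S /a sumrB subr_ge0.
  have lnp (x : 'I_N -> R) : (forall i, 0 < x i) ->
      \sum_(i < N | (i < k)%N) ln (x i) = ln (\prod_(i < N | (i < k)%N) x i).
    move=> x0; rewrite -[LHS]expRK expR_sum; congr ln.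
    by apply: eq_bigr => i _; rewrite lnK// posrE.
  rewrite !lnp// ler_ln ?posrE ?prodr_gt0//; exact: yz.
(* Abel summation as an induction: passing to the next index replaces the weight of the nonnegative
   sum [S] by a smaller one. *)
have T k (kN : (k < N)%N) :
    y (Ordinal kN) * S k.+1 <= \sum_(i < N | (i < k.+1)%N) y i * a i.
  elim: k kN => [|k IH] kN.
    by rewrite /S (big_lt_recr _ kN) [leRHS](big_lt_recr _ kN) /= !big_pred0// !add0r.
  have kN' := ltnW kN; have IHk := IH kN'.
  rewrite /S (big_lt_recr _ kN) [leRHS](big_lt_recr _ kN) /= mulrDr lerD2r.
  apply: le_trans IHk; apply: ler_wpM2r; first exact: S0.
  exact: ydec.
have TK : 0 <= \sum_(i < N | (i < K)%N) y i * a i.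
  case: K KN => [|k] kN; first by rewrite big_pred0.
  by apply: le_trans (T k kN); rewrite mulr_ge0 ?S0// ltW.
rewrite -subr_ge0 -sumrB; apply: (le_trans TK); apply: ler_sum => i _.
rewrite /a -ln_div ?posrE//.
have h := expR_ge1Dx (ln (z i / y i)); rewrite lnK ?posrE ?divr_gt0// in h.
have -> : z i - y i = y i * (z i / y i - 1) by field; exact: lt0r_neq0.
rewrite ler_wpM2l ?(ltW (y0 i))//; lra.
Qed.

(** The extremal principle behind both Ky Fan bounds: the additive one directly, the multiplicative
    one after taking logarithms. *)
Lemma sum_top_ge N (d w : 'I_N -> R) k :
  (forall i j : 'I_N, (i <= j)%N -> d j <= d i) ->
  (forall i, 0 <= w i <= 1) -> (0 < k <= N)%N -> \sum_i w i = k%:R ->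
  \sum_i d i * w i <= \sum_(i < N | (i < k)%N) d i.
Proof.
move=> dd w01 /andP[k0 kN] wk.
have kN' : (k.-1 < N)%N by rewrite prednK.
set t := d (Ordinal kN').
rewrite [leRHS]big_mkcond /= -subr_ge0 -sumrB.
pose b (i : 'I_N) : R := (i < k)%N%:R.
(* Since [b] and [w] both have sum [k], the threshold [t], the [k]-th value of [d], can be
   subtracted from [d]; each term becomes [(d i - t) * (b i - w i)], whose factors never have
   opposite signs. *)
rewrite [leLHS](_ : 0 = \sum_i t * (b i - w i)); last first.
  rewrite -mulr_sumr sumrB wk /b -natr_sum -big_mkcond /= (big_ord_narrow kN).
  by rewrite sum1_card card_ord subrr mulr0.
apply: ler_sum => i _; have /andP[w0 w1] := w01 i; rewrite /b.
case: ltnP => ik.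
  have td : t <= d i by apply: dd; rewrite /= -ltnS prednK.
  have -> : d i - d i * w i = d i * (1 - w i) by ring.
  by apply: ler_wpM2r ; rewrite ?subr_ge0.
have td : d i <= t by apply: dd; rewrite /= (leq_trans (leq_pred _)).
by rewrite !sub0r mulrN lerN2; exact: ler_wpM2r.
Qed.

End scalar.

(** * Cauchy-Binet formula and Ky Fan principle *)

Section determinants.
Context {R : realType}.
Local Notation C := (Cx R).

(* Cauchy-Binet: the index maps [f] are not required to be increasing, so each
   minor is counted [k!] times. *)
Lemma det_spec N k (W : 'M[C]_(N, k)) (d : 'rV[R]_N) :
  \det (spec W d) = rc (k`!%:R^-1 * \sum_(f : {ffun 'I_k -> 'I_N})
    sq (\det (\matrix_(i, j) W (f i) j)) * \prod_i d 0 (f i)).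
Proof.
pose Wf (f : {ffun 'I_k -> 'I_N}) : 'M[C]_k := \matrix_(i, j) W (f i) j.
pose pd f := rc (\prod_(i < k) d 0 ((f : {ffun 'I_k -> 'I_N}) i)).
pose T (f : {ffun 'I_k -> 'I_N}) := (\prod_i (W (f i) i)^*) * pd f * \det (Wf f).
have E : \det (spec W d) = \sum_f T f.
  rewrite /determinant.
  under eq_bigr => s _.
    under eq_bigr => i _ do rewrite specE.
    rewrite (bigA_distr_bigA (fun i l => (W l i)^* * rc (d 0 l) * W l (s i))) mulr_sumr /=.
    over.
  rewrite exchange_big /=; apply: eq_bigr => f _; rewrite /T /determinant mulr_sumr.
  apply: eq_bigr => s _; rewrite !big_split /= /pd rmorph_prod /=.
  rewrite mulrCA; congr (_ * (_ * _)).
  by apply: eq_bigr => i _; rewrite mxE.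
pose fs (f : {ffun 'I_k -> 'I_N}) (s : 'S_k) : {ffun 'I_k -> 'I_N} := [ffun i => f (s i)].
have fsinj s : injective (fs^~ s).
  move=> f g /ffunP h; apply/ffunP => i; have := h ((s^-1)%g i).
  by rewrite !ffunE permKV.
have Es s : \sum_f T f = \sum_f T (fs f s) by rewrite (reindex_inj (fsinj s)).
have k0 : (k`!%:R : C) != 0 by rewrite pnatr_eq0 -lt0n fact_gt0.
(* Averaging over the relabellings of one index map [f] produces the Leibniz expansion of the
   conjugate minor, so that the product of conjugate entries in [T] becomes a second determinant. *)
have kE : k`!%:R * \sum_f T f = \sum_(s : 'S_k) \sum_f T (fs f s).
  rewrite [RHS](eq_bigr (fun=> \sum_f T f)) => [|s _]; last exact/esym/Es.
  by rewrite sumr_const card_Sn mulr_natl.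
apply: (mulfI k0); rewrite E kE rmorphM /= fmorphV /= rmorph_nat mulVKf//.
rewrite exchange_big rmorph_sum /=; apply: eq_bigr => f _.
have pdE s : pd (fs f s) = pd f.
  rewrite /pd; congr rc; rewrite [RHS](reindex_inj (@perm_inj _ s)) /=.
  by apply: eq_bigr => i _; rewrite ffunE.
have detE s : \det (Wf (fs f s)) = (-1) ^+ s * \det (Wf f).
  have -> : Wf (fs f s) = row_perm s (Wf f).
    by apply/matrixP => i j; rewrite !mxE ffunE.
  by rewrite row_permE det_mulmx det_perm.
rewrite /T rmorphM /= -sqE -/(pd f) -/(Wf f) -mulrA [_ * pd f]mulrC.
have -> : (\det (Wf f))^* = \sum_(s : 'S_k) (-1) ^+ s * \prod_i (W (fs f s i) i)^*.
  rewrite -det_tr /determinant rmorph_sum /=; apply: eq_bigr => s _.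
  rewrite rmorphM /= rmorph_sign rmorph_prod; congr (_ * _).
  by apply: eq_bigr => i _; rewrite !mxE ffunE.
rewrite mulr_suml; apply: eq_bigr => s _; rewrite pdE detE.
by rewrite mulrCA !mulrA; congr (_ * _); rewrite mulrAC.
Qed.

Definition rdet n (A : 'M[C]_n) : R := re (\det A).

(** The Cauchy-Binet weights. They do not depend on [d], so determinants of [spec W d] for different
    [d] are sums with common weights; for an isometry these have total mass 1. *)
Definition minor2 N k (W : 'M[C]_(N, k)) (f : {ffun 'I_k -> 'I_N}) : R :=
  k`!%:R^-1 * sq (\det (\matrix_(i, j) W (f i) j)).

Lemma minor2_ge0 N k (W : 'M[C]_(N, k)) f : 0 <= minor2 W f.
Proof. by rewrite mulr_ge0 ?sq_ge0// invr_ge0. Qed.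

Lemma rdet_spec N k (W : 'M[C]_(N, k)) (d : 'rV[R]_N) :
  rdet (spec W d) = \sum_f minor2 W f * \prod_i d 0 (f i).
Proof.
rewrite /rdet det_spec rcK mulr_sumr; apply: eq_bigr => f _.
by rewrite mulrA.
Qed.

Lemma spec_const1 m n (U : 'M[C]_(m, n)) : spec U (const_mx 1) = U^t* *m U.
Proof. by rewrite spec.unlock rdiag_const mulmx1. Qed.

Lemma sum_minor2 N k (W : 'M[C]_(N, k)) : \sum_f minor2 W f = rdet (W^t* *m W).
Proof.
rewrite -spec_const1 rdet_spec; apply: eq_bigr => f _.
by rewrite big1 ?mulr1// => i _; rewrite mxE.
Qed.

Lemma minor2_inj N k (W : 'M[C]_(N, k)) (f : {ffun 'I_k -> 'I_N}) :
  ~~ injectiveb f -> minor2 W f = 0.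
Proof.
move=> /injectivePn[i [j ij fij]]; rewrite /minor2.
rewrite (determinant_alternate ij) => [|l]; last by rewrite !mxE fij.
by apply/eqP; rewrite mulf_eq0 sq_eq0 eqxx orbT.
Qed.

(** On logarithms this is [sum_top_ge] with the indicator of the range of [f] as weight; injectivity
    makes its total [k]. *)
Lemma prod_top_ge N (d : 'I_N -> R) k (f : {ffun 'I_k -> 'I_N}) :
  (forall i, 0 < d i) -> (forall i j : 'I_N, (i <= j)%N -> d j <= d i) ->
  injective f -> (0 < k <= N)%N ->
  \prod_i d (f i) <= \prod_(i < N | (i < k)%N) d i.
Proof.
move=> d0 dd finj k0N.
pose b (j : 'I_N) : R := (j \in codom f)%:R.
have bE (F : 'I_N -> R) : \sum_i F (f i) = \sum_j F j * b j.
  transitivity (\sum_(j <- codom f) F j); first by rewrite big_image.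
  rewrite big_uniq /=; last exact/injectiveP.
  by rewrite big_mkcond; apply: eq_bigr => j _; rewrite /b; case: ifP; rewrite ?mulr1 ?mulr0.
have h : \sum_j ln (d j) * b j <= \sum_(i < N | (i < k)%N) ln (d i).
  apply: sum_top_ge => // [i j ij|i|].
  - by rewrite ler_ln ?posrE// dd.
  - by rewrite /b; case: (_ \in _); rewrite ?lexx ?ler01.
  - under eq_bigr do rewrite -[b _]mul1r.
    by rewrite -(bE (fun=> 1)) sumr_const card_ord.
rewrite -bE in h; rewrite -ler_expR !expR_sum in h.
rewrite (eq_bigr (fun i => expR (ln (d (f i))))) => [|i _]; last by rewrite lnK// posrE.
apply: (le_trans h); rewrite le_eqVlt; apply/orP; left; apply/eqP.
by apply: eq_bigr => i _; rewrite lnK// posrE.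
Qed.

(** The determinant is an average, with weights [minor2], of products over index maps; those that
    are not injective have weight 0. *)
Lemma rdet_top_ge N k (W : 'M[C]_(N, k)) (d : 'rV[R]_N) :
  (forall i, 0 < d 0 i) -> (forall i j : 'I_N, (i <= j)%N -> d 0 j <= d 0 i) ->
  W^t* *m W = 1%:M -> (0 < k <= N)%N ->
  rdet (spec W d) <= \prod_(i < N | (i < k)%N) d 0 i.
Proof.
move=> d0 dd W1 kN; rewrite rdet_spec.
have S1 : \sum_f minor2 W f = 1 by rewrite sum_minor2 W1 /rdet det1.
rewrite -[leRHS]mul1r -[Y in _ <= Y * _]S1 mulr_suml; apply: ler_sum => f _.
have [finj|finj] := boolP (injectiveb f); last by rewrite minor2_inj// !mul0r.
apply: ler_wpM2l; first exact: minor2_ge0.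
exact: (@prod_top_ge _ (fun i => d 0 i) _ f d0 dd (injectiveP _ finj) kN).
Qed.

Lemma prod_powR (I : finType) (x : I -> R) (P : pred I) r : (forall i, 0 <= x i) ->
  \prod_(i | P i) x i `^ r = (\prod_(i | P i) x i) `^ r.
Proof.
move=> x0; pose K (a b : R) := a = b `^ r /\ 0 <= b.
suff [] : K (\prod_(i | P i) x i `^ r) (\prod_(i | P i) x i) by [].
elim/big_ind2 : _ => [|a b c d [-> b0] [-> d0]|i _]; split=> //.
- by rewrite powR1.
- by rewrite powRM.
- exact: mulr_ge0.
Qed.

(** With [B = X^(-1/2) A X^(-1/2) = U^* b U] and [W = U X^(1/2) V], the compressions of [X], [A] and
    [X #_r A] are [spec W] at [1], [b] and [b^r]. Cauchy-Binet expands all three with the same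
    weights, and Jensen's inequality compares them. *)
Lemma rdet_wgm N k r (X A : 'M[C]_N) (V : 'M[C]_(N, k)) : 0 <= r <= 1 ->
  pd X -> pd A -> 0 < rdet (V^t* *m X *m V) ->
  rdet (V^t* *m wgm r X A *m V) <=
    rdet (V^t* *m X *m V) `^ (1 - r) * rdet (V^t* *m A *m V) `^ r.
Proof.
move=> r01 pX pA dX0.
have hH : herm (mpw X 2^-1) by exact: herm_mxpow.
have pB := pd_sandwich_half (- 2^-1) pX pA.
have [U [b [uU BE b0]]] := posdef_specP pB.
pose W := U *m (mpw X 2^-1 *m V).
have VS d : V^t* *m (mpw X 2^-1 *m spec U d *m mpw X 2^-1) *m V = spec W d.
  by rewrite -!spec_mul adjM (hermK hH) !mulmxA.
have E1 : V^t* *m wgm r X A *m V = spec W (map_mx (fun x => x `^ r) b).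
  by rewrite wgm.unlock BE mxpow_spec// VS.
have E2 : V^t* *m A *m V = spec W b.
  rewrite -VS -BE !mulmxA; congr (_ *m _).
  rewrite -(mulmxA _ (mpw X 2^-1)) mxpowNr// mulmx1 -!mulmxA mxpowN// mulmx1.
  by [].
have E3 : V^t* *m X *m V = W^t* *m W.
  by rewrite -spec_const1 -VS spec_unit// mulmx1 mxpow_half.
rewrite E1 E2 !E3 -!sum_minor2 in dX0 *.
rewrite !rdet_spec.
under eq_bigr => f _.
  rewrite (_ : \prod_i _ = (\prod_i b 0 (f i)) `^ r); last first.
    rewrite (eq_bigr (fun i => b 0 (f i) `^ r)) => [|i _]; last by rewrite mxE.
    by rewrite prod_powR// => i; exact: ltW.
  over.
apply: jensen_powR => // [f|f]; first exact: minor2_ge0.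
by apply: prodr_gt0 => i _.
Qed.

End determinants.

(** * Top eigenvectors and log-majorization of geometric means *)

Section kyfan.
Context {R : realType}.
Local Notation C := (Cx R).

Definition idcols N k : 'M[C]_(N, k) := \matrix_(i, j) (i == j :> nat)%:R.

Lemma spec_idcols N k (kN : (k <= N)%N) d :
  spec (idcols N k) d = rdiag (\row_j d 0 (widen_ord kN j)).
Proof.
apply/matrixP => i j; rewrite specE (bigD1 (widen_ord kN i))//= big1 => [|l li]; last first.
  rewrite !mxE (negbTE (_ : (l : nat) != i)) ?conjC0 ?mul0r//.
rewrite addr0 rdiag.unlock !mxE /= eqxx conjC1 mul1r -(inj_eq val_inj) /=.
by rewrite mulr_natr.
Qed.

Lemma idcols_isometry N k : (k <= N)%N -> (idcols N k)^t* *m idcols N k = 1%:M.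
Proof.
move=> kN; rewrite -spec_const1 (spec_idcols kN) -(spec_unit (unitary1 _)) spec1.
by congr rdiag; apply/rowP => j; rewrite !mxE.
Qed.

Lemma sum_narrow N k (kN : (k <= N)%N) (F : 'I_N -> R) :
  \sum_(i < N | (i < k)%N) F i = \sum_(j < k) F (widen_ord kN j).
Proof. by rewrite (big_ord_narrow kN). Qed.

Lemma prod_narrow N k (kN : (k <= N)%N) (F : 'I_N -> R) :
  \prod_(i < N | (i < k)%N) F i = \prod_(j < k) F (widen_ord kN j).
Proof. by rewrite (big_ord_narrow kN). Qed.

Lemma rq_rdiag_delta n (d : 'rV[R]_n) j : rq (rdiag d) (delta_mx j 0) = d 0 j.
Proof. by rewrite rq_delta rdiag.unlock !mxE eqxx mulr1n rcK. Qed.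

Lemma top_eigenvectors N k (kN : (k <= N)%N) (M : 'M[C]_N) : herm M ->
  exists V : 'M[C]_(N, k), [/\ V^t* *m V = 1%:M,
    \sum_j rq M (V *m delta_mx j 0) = \sum_(i < N | (i < k)%N) eigvals M 0 i &
    rdet (V^t* *m M *m V) = \prod_(i < N | (i < k)%N) eigvals M 0 i].
Proof.
move=> /herm_spec_eigvals[U uU ME]; pose V := U^t* *m idcols N k.
have UV : U *m V = idcols N k by rewrite mulmxA (unitarymxP uU) mul1mx.
have VMV : V^t* *m M *m V = rdiag (\row_j eigvals M 0 (widen_ord kN j)).
  by rewrite {1}ME spec_mul UV (spec_idcols kN).
exists V; split.
- rewrite -[V^t*]mulmx1 -(unitary_adj uU) mulmxA -mulmxA -adjM UV.
  exact: idcols_isometry.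
- rewrite (sum_narrow kN); apply: eq_bigr => j _.
  by rewrite -rq_conj VMV rq_rdiag_delta mxE.
- rewrite (prod_narrow kN) VMV /rdet rdiag.unlock det_diag.
  rewrite (eq_bigr (fun j => rc (eigvals M 0 (widen_ord kN j)))) => [|j _]; last by rewrite !mxE.
  by rewrite -rmorph_prod rcK.
Qed.

(** [P = W W^*] is an orthogonal projection, so its diagonal entry [w] at [l] equals the squared
    norm of its column [l], which is at least [w ^ 2]. *)
Lemma isometry_row_le1 N k (W : 'M[C]_(N, k)) l : W^t* *m W = 1%:M ->
  \sum_j sq (W l j) <= 1.
Proof.
move=> W1; pose P := W *m W^t*.
have PP : P *m P = P by rewrite /P !mulmxA -(mulmxA W) W1 mulmx1.
have hP : herm P by rewrite herm.unlock /P adjM trmxCK.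
have PE : re (P l l) = \sum_j sq (W l j).
  rewrite /P mxE raddf_sum; apply: eq_bigr => j _.
  by rewrite /= !mxE mulrC sqE rcK.
have : re ((P *m P) l l) = \sum_m sq (P m l).
  rewrite mxE raddf_sum; apply: eq_bigr => m _.
  by rewrite /= (hermE l m hP) sqE rcK.
rewrite PP PE (bigD1 l)//= => E.
set w := \sum_j _ in PE E *.
have s0 : 0 <= \sum_(i < N | i != l) sq (P i l).
  by apply: sumr_ge0 => m _; exact: sq_ge0.
have : w ^+ 2 <= w.
  rewrite [leRHS]E -[Y in Y ^+ 2]PE.
  have -> : sq (P l l) = re (P l l) ^+ 2 + im (P l l) ^+ 2 by rewrite sq.unlock.
  by rewrite -addrA lerDl addr_ge0 ?sqr_ge0.
rewrite !leNgt; apply: contra => w1.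
by rewrite expr2 ltr_pMr// (lt_trans ltr01).
Qed.

Lemma sum_isometry N k (W : 'M[C]_(N, k)) : W^t* *m W = 1%:M ->
  \sum_l \sum_j sq (W l j) = k%:R.
Proof.
move=> W1; rewrite exchange_big /= (eq_bigr (fun=> 1)).
  by rewrite sumr_const card_ord.
move=> j _; have /matrixP/(_ j j) := W1; rewrite !mxE eqxx mulr1n => /(congr1 re).
rewrite raddf_sum /= => E; rewrite -[RHS]E; apply: eq_bigr => l _.
by rewrite !mxE sqE rcK.
Qed.

(** In an eigenbasis the left side weights each eigenvalue by the squared norm of a row of the
    isometry [U V]; these weights lie in [[0, 1]] and sum to [k]. *)
Lemma kyfan_le N k (M : 'M[C]_N) (V : 'M[C]_(N, k)) : herm M ->
  V^t* *m V = 1%:M -> (0 < k <= N)%N ->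
  \sum_j rq M (V *m delta_mx j 0) <= \sum_(i < N | (i < k)%N) eigvals M 0 i.
Proof.
move=> hM V1 kN; have [U uU ME] := herm_spec_eigvals hM; pose W := U *m V.
have W1 : W^t* *m W = 1%:M.
  by rewrite adjM mulmxA -(mulmxA _ _ U) (unitary_adj uU) mulmx1.
have -> : \sum_j rq M (V *m delta_mx j 0) =
    \sum_l eigvals M 0 l * \sum_j sq (W l j).
  rewrite {1}ME; under eq_bigr do rewrite rq_spec mulmxA -colE.
  rewrite exchange_big; apply: eq_bigr => l _; rewrite mulr_sumr.
  by apply: eq_bigr => j _; rewrite [col _ _ _ _]mxE.
apply: sum_top_ge => //.
- by move=> i j ij; exact: eigvals_sorted.
- move=> i; rewrite isometry_row_le1// andbT.
  by apply: sumr_ge0 => j _; exact: sq_ge0.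
- exact: sum_isometry.
Qed.

Lemma rdet_gt0 n (A : 'M[C]_n) : pd A -> 0 < rdet A.
Proof.
move=> /posdef_specP[U [d [uU -> d0]]]; rewrite /rdet.
have -> : \det (spec U d) = rc (\prod_i d 0 i).
  rewrite spec.unlock !det_mulmx mulrAC -det_mulmx (unitary_adj uU) det1 mul1r.
  rewrite rdiag.unlock det_diag rmorph_prod.
  by apply: eq_bigr => i _; rewrite mxE.
by rewrite rcK prodr_gt0.
Qed.

Lemma rdet_isometry_le N k (A : 'M[C]_N) (V : 'M[C]_(N, k)) : pd A ->
  V^t* *m V = 1%:M -> (0 < k <= N)%N ->
  rdet (V^t* *m A *m V) <= \prod_(i < N | (i < k)%N) eigvals A 0 i.
Proof.
move=> pA V1 kN; have [U [uU AE d0]] := posdef_spec_eigvals pA.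
rewrite {1}AE spec_mul; apply: rdet_top_ge => //.
- by move=> i j ij; exact: eigvals_sorted.
- by rewrite adjM mulmxA -(mulmxA _ _ U) (unitary_adj uU) mulmx1.
Qed.

(** For [V] made of top eigenvectors of [X #_r A], the left side is the determinant of a compression
    by [V]; [rdet_wgm] passes to the compressions of [X] and [A], which the products of their own
    top eigenvalues bound. *)
Lemma wgm_logmaj N k r (X A : 'M[C]_N) : 0 <= r <= 1 -> pd X -> pd A -> (k <= N)%N ->
  \prod_(i < N | (i < k)%N) eigvals (wgm r X A) 0 i <=
  \prod_(i < N | (i < k)%N) (eigvals X 0 i `^ (1 - r) * eigvals A 0 i `^ r).
Proof.
move=> r01 pX pA kN; case: (posnP k) => [->|k0]; first by rewrite !big_pred0.
have pM : pd (wgm r X A) := pd_wgm r pX pA.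
have [V [V1 _ <-]] := top_eigenvectors kN (posdef_herm pM).
have dX0 : 0 < rdet (V^t* *m X *m V) by apply: rdet_gt0; exact: posdef_conj V1 pX.
have dA0 : 0 < rdet (V^t* *m A *m V) by apply: rdet_gt0; exact: posdef_conj V1 pA.
apply: (le_trans (rdet_wgm r01 pX pA dX0)).
have kN' : (0 < k <= N)%N by rewrite k0.
have [_ [_ _ x0]] := posdef_spec_eigvals pX; have [_ [_ _ a0]] := posdef_spec_eigvals pA.
rewrite big_split /= !prod_powR ; try (by move=> i; exact: ltW).
have hX := rdet_isometry_le pX V1 kN'; have hA := rdet_isometry_le pA V1 kN'.
move: (rdet _) (rdet _) dX0 dA0 hX hA => dX dA dX0 dA0 hX hA.
have /andP[r0 r1] := r01.
apply: ler_pM; rewrite ?powR_ge0//; apply: ge0_ler_powR; rewrite ?nnegrE ?subr_ge0//.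
- exact: ltW.
- exact: le_trans (ltW dX0) hX.
- exact: ltW.
- exact: le_trans (ltW dA0) hA.
Qed.

Lemma wgm_weakmaj N k r (X A : 'M[C]_N) : 0 <= r <= 1 -> pd X -> pd A -> (k <= N)%N ->
  \sum_(i < N | (i < k)%N) eigvals (wgm r X A) 0 i <=
  \sum_(i < N | (i < k)%N) eigvals X 0 i `^ (1 - r) * eigvals A 0 i `^ r.
Proof.
move=> r01 pX pA kN.
have [_ [_ _ x0]] := posdef_spec_eigvals pX; have [_ [_ _ a0]] := posdef_spec_eigvals pA.
have [_ [_ _ m0]] := posdef_spec_eigvals (pd_wgm r pX pA).
apply: logmaj_weakmaj => //.
- by move=> i; rewrite mulr_gt0 ?powR_gt0.
- by move=> i j ij; exact: eigvals_sorted.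
- by move=> k' kN'; exact: wgm_logmaj.
Qed.

End kyfan.

(** * Topology of positive definite matrices *)

Section topology.
Context {R : realType} {N : nat}.
Local Notation C := (Cx R).

Definition mxclose (e : R) (A B : 'M[C]_N) :=
  forall i j, `|re (A i j - B i j)| < e /\ `|im (A i j - B i j)| < e.

Lemma normC_re_im (z : C) : `|re z| <= re `|z| /\ `|im z| <= re `|z|.
Proof.
have -> : re `|z| = Num.sqrt (re z ^+ 2 + im z ^+ 2).
  by rewrite -[RHS]rcK; congr re; exact: (normc_def (z : R[i])).
by split; rewrite -[leLHS]sqrtr_sqr ler_sqrt ?addr_ge0 ?sqr_ge0// ?lerDl ?lerDr ?sqr_ge0.
Qed.

Lemma normC_lt (z : C) (e : R) : `|re z| < e / 2 -> `|im z| < e / 2 -> `|z| < rc e.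
Proof.
move=> h1 h2.
have zE : z = rc (re z) + 'i * rc (im z) by exact: (complexE (z : R[i])).
have e1 (x : R) : `|rc x| = rc `|x|.
  apply/eqP; rewrite -(@eqrXn2 _ 2)// ?rc_ge0// normCK conj_rc -!rmorphM /= -expr2.
  by rewrite -rmorphXn /= real_normK ?num_real.
rewrite zE; apply: (le_lt_trans (ler_normD _ _)).
rewrite normrM normCi mul1r !e1 -rmorphD /=.
by rewrite -[_ < _]/(real_complex R _ < real_complex R _) ltcR; lra.
Qed.

(** Translates the topology induced from complex matrices into real tolerances, the form in which
    continuity is handled below. *)
Lemma openPDP (O : set (PD R N)) :
  open O <-> forall A : PD R N, O A ->
    exists2 e : R, 0 < e & forall B : PD R N, mxclose e A B -> O B.
Proof.
split=> [ [G oG <-] A OA|h].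
  have /nbhs_ballP[e /= e0 he] : nbhs (A : 'M[C]_N) G by exact: open_nbhs_nbhs.
  have eE : e = rc (re e).
    by apply: conj_fix_rc; apply/CrealP; exact: gtr0_real.
  rewrite eE rc_gt0 in e0.
  (* Half of the radius, because the modulus is at most the sum of the absolute real and imaginary
     parts. *)
  exists (re e / 2); first by rewrite divr_gt0.
  move=> B AB; apply: he; split; first by rewrite eE rc_gt0.
  by move=> i j; rewrite /ball /= eE; apply: normC_lt; have [] := AB i j.
rewrite openE => A OA; have [e e0 he] := h A OA.
have c : continuous (set_val : PD R N -> 'M[C]_N).
  exact: (@initial_continuous _ _ (set_val : set_type (@posdef R N : set 'M[Cx R]_N) -> _)).
have : nbhs A ((set_val : PD R N -> 'M[C]_N) @^-1` mxclose e (mx_of_PD A)).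
  apply: c; apply/nbhs_ballP; exists (rc e) => /=; first by rewrite rc_gt0.
  move=> M [_ hM] i j; have := hM i j; rewrite /ball /= => hij.
  have : re `|mx_of_PD A i j - M i j| < e.
    by move: hij; rewrite ltcE => /andP[].
  have [h1 h2] := normC_re_im (mx_of_PD A i j - M i j).
  by move=> h3; split; apply: le_lt_trans h3.
by apply: filterS => B; exact: he.
Qed.

End topology.

(** * Neighbourhoods in the Loewner order *)

Section nearness.
Context {R : realType} {N : nat}.
Local Notation C := (Cx R).
Implicit Types (A B : 'M[C]_N) (v : 'cV[C]_N).

Lemma pd_lower A : pd A -> exists2 c : R, 0 < c & forall v, c * nrm2 v <= rq A v.
Proof.
move=> /posdef_specP[U [d [uU -> d0]]].
(* The inverse of this sum lies below every eigenvalue. It stands in for their minimum, and the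
   summand 1 covers the empty index set. *)
have s0 : 0 < 1 + \sum_i (d 0 i)^-1.
  by apply: ltr_wpDr => //; apply: sumr_ge0 => i _; rewrite invr_ge0 ltW.
exists (1 + \sum_i (d 0 i)^-1)^-1; first by rewrite invr_gt0.
move=> v; rewrite -rq1 -(spec_unit uU) !rq_spec mulr_sumr; apply: ler_sum => i _.
rewrite mxE mul1r; apply: ler_wpM2r; first exact: sq_ge0.
rewrite -[leRHS]invrK lef_pV2 ?posrE ?invr_gt0// (bigD1 i)//= addrCA lerDl.
by apply: addr_ge0 => //; apply: sumr_ge0 => j _; rewrite invr_ge0 ltW.
Qed.

Lemma rq_sum A v : rq A v = \sum_i \sum_j re ((v i 0)^* * A i j * v j 0).
Proof.
rewrite rq.unlock /qform mxE raddf_sum exchange_big /=; apply: eq_bigr => j _.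
rewrite mxE mulr_suml raddf_sum; apply: eq_bigr => i _.
by rewrite /= !mxE.
Qed.

Lemma re_mul_bound (a z b : C) e : `|re z| <= e -> `|im z| <= e ->
  `|re (a^* * z * b)| <= e * (sq a + sq b).
Proof.
rewrite sq.unlock; case: a z b => [a a'] [z z'] [b b']; rewrite /re /im /= => h1 h2.
have e0 : 0 <= e := le_trans (normr_ge0 _) h1.
have -> : (a * z - - a' * z') * b - (a * z' + - a' * z) * b' =
  z * (a * b + a' * b') + z' * (a' * b - a * b') by ring.
have g1 : `|a * b + a' * b'| <= (a ^+ 2 + a' ^+ 2 + (b ^+ 2 + b' ^+ 2)) / 2.
  rewrite ler_norml; apply/andP; split.
    have := sqr_ge0 (a + b); have := sqr_ge0 (a' + b'); rewrite !expr2; lra.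
  have := sqr_ge0 (a - b); have := sqr_ge0 (a' - b'); rewrite !expr2; lra.
have g2 : `|a' * b - a * b'| <= (a ^+ 2 + a' ^+ 2 + (b ^+ 2 + b' ^+ 2)) / 2.
  rewrite ler_norml; apply/andP; split.
    have := sqr_ge0 (a' + b); have := sqr_ge0 (a - b'); rewrite !expr2; lra.
  have := sqr_ge0 (a' - b); have := sqr_ge0 (a + b'); rewrite !expr2; lra.
apply: (le_trans (ler_normD _ _)); rewrite !normrM.
have k1 := ler_pM (normr_ge0 _) (normr_ge0 _) h1 g1.
have k2 := ler_pM (normr_ge0 _) (normr_ge0 _) h2 g2.
by apply: (le_trans (lerD k1 k2)); rewrite -mulrDr; apply: ler_wpM2l => //; lra.
Qed.

Lemma rq_bound A v e : (forall i j, `|re (A i j)| <= e /\ `|im (A i j)| <= e) ->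
  `|rq A v| <= 2 * N%:R * e * nrm2 v.
Proof.
move=> h; rewrite rq_sum; apply: (le_trans (ler_norm_sum _ _ _)).
have h' i j : `|re ((v i 0)^* * A i j * v j 0)| <= e * (sq (v i 0) + sq (v j 0)).
  by apply: re_mul_bound; have [] := h i j.
apply: (le_trans (ler_sum _ (fun i _ => le_trans (ler_norm_sum _ _ _)
  (ler_sum _ (fun j _ => h' i j))))).
rewrite le_eqVlt; apply/orP; left; apply/eqP; rewrite nrm2.unlock.
under eq_bigr => i _ do rewrite -mulr_sumr big_split /= sumr_const card_ord.
rewrite -mulr_sumr big_split /= sumrMnl sumr_const card_ord.
by move: (\sum_i _) => S; rewrite -[S *+ N]mulr_natr; ring.
Qed.

(** Entrywise closeness becomes a two-sided multiplicative bound, to which monotonicity and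
    homogeneity apply. *)
Lemma pd_near A (dl : R) : pd A -> 0 < dl -> exists2 e : R, 0 < e &
  forall B, mxclose e A B -> lel (rc (1 - dl) *: A) B /\ lel B (rc (1 + dl) *: A).
Proof.
move=> pA dl0; have [c c0 hc] := pd_lower pA.
have N0 : 0 < 2 * N%:R + 1 :> R by rewrite ltr_wpDl// mulr_ge0.
(* [rq_bound] costs a factor [2 N] and [pd_lower] supplies [c]; the added 1 keeps the denominator
   positive when [N = 0]. *)
exists (dl * c / (2 * N%:R + 1)); first by rewrite divr_gt0// mulr_gt0.
set e := _ / _; move=> B AB.
have hb v : `|rq (A - B) v| <= dl * rq A v.
  apply: (le_trans (rq_bound v (e := e) _)).
    by move=> i j; have [h1 h2] := AB i j; rewrite !mxE; split; exact: ltW.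
  apply: (@le_trans _ _ (dl * (c * nrm2 v))); last by rewrite ler_pM2l.
  rewrite mulrA; apply: ler_wpM2r; first exact: nrm2_ge0.
  rewrite /e mulrA ler_pdivrMr// mulrC ler_pM2l ?mulr_gt0//; lra.
split=> v; rewrite rqZ; have := hb v; rewrite rqB ler_norml => /andP[]; lra.
Qed.

End nearness.

Section hmono.
Context {R : realType} {N : nat}.
Local Notation C := (Cx R).
Implicit Types (A B : PD R N).

Lemma PD_pd A : pd (A : 'M[C]_N).
Proof. by rewrite pd.unlock; exact: PD_posdef. Qed.

Definition pcont (g : PD R N -> R) := forall A (e : R), 0 < e ->
  exists2 t : R, 0 < t & forall B, mxclose t A B -> `|g B - g A| < e.

(* Monotone functions of homogeneity degree at most one. *)
Definition hmono (g : PD R N -> R) := forall (c : R) A B, 1 <= c ->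
  lel A (rc c *: (B : 'M[C]_N)) -> g A <= c * g B.

Lemma hmono_pcont g : (forall A, 0 <= g A) -> hmono g -> pcont g.
Proof.
move=> g0 hg A e e0.
(* The bound [1/2] keeps [1 - dl] positive; the other bound makes [dl * g A], the final error,
   smaller than [e], with [g A + 1] as a positive divisor. *)
pose dl := Num.min 2^-1 (e / (g A + 1) / 2).
have gA1 : 0 < g A + 1 by rewrite ltr_wpDl.
have dl0 : 0 < dl by rewrite lt_min !divr_gt0// invr_gt0 ltr0n.
have dl1 : dl <= 2^-1 by rewrite ge_min lexx.
have dle : dl * (g A + 1) <= e / 2.
  by rewrite -ler_pdivlMr// mulrAC ge_min lexx orbT.
have [t t0 ht] := pd_near (PD_pd A) dl0.
exists t => // B /ht[h1 h2].
have u1 : g B <= (1 + dl) * g A by apply: hg h2; lra.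
have u2 : g A <= (1 - dl)^-1 * g B.
  apply: hg; first by rewrite invf_ge1; lra.
  move=> v; have := h1 v; rewrite !rqZ => h.
  by rewrite mulrC ler_pdivlMr; lra.
have u3 : (1 - dl) * g A <= g B.
  by rewrite -[leRHS](mulVKf (_ : 1 - dl != 0)) ?ler_pM2l//; lra.
rewrite ltr_norml; apply/andP; split; lra.
Qed.

Lemma pcont_open g : pcont g -> forall x : R, open [set A | x < g A].
Proof.
move=> hg x; apply/openPDP => A /= xA.
have [|t t0 ht] := hg A (g A - x); first by rewrite subr_gt0.
by exists t => // B /ht; rewrite ltr_norml => /andP[]; lra.
Qed.

Lemma borel_open (O : set (PD R N)) : open O -> measurable (O : set (borel (PD R N))).
Proof. by move=> oO; exact: sub_sigma_algebra. Qed.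

Lemma pcont_measurable g : pcont g -> measurable_fun [set: borel (PD R N)] g.
Proof.
move=> hg; apply: (measurability _ (measurable_realfun.RGenOInfty.measurableE R)).
move=> /= _ [_ [a ->]] <-; apply: measurableI => //; apply: borel_open.
rewrite preimage_itvoy; exact: pcont_open.
Qed.

Lemma pcontB f g : pcont f -> pcont g -> pcont (fun A => f A - g A).
Proof.
move=> hf hg A e e0; have e2 : 0 < e / 2 by rewrite divr_gt0.
have [t1 t10 h1] := hf A _ e2; have [t2 t20 h2] := hg A _ e2.
exists (Num.min t1 t2); first by rewrite lt_min t10.
move=> B AB; have c1 : mxclose t1 A B.
  by move=> i j; have [] := AB i j; rewrite !lt_min => /andP[? _] /andP[].
have c2 : mxclose t2 A B.
  by move=> i j; have [] := AB i j; rewrite !lt_min => /andP[_ ?] /andP[].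
have := h1 B c1; have := h2 B c2.
by rewrite !ltr_norml => /andP[? ?] /andP[? ?]; apply/andP; split; lra.
Qed.

Lemma pcontZ c g : 0 < c -> pcont g -> pcont (fun A => c * g A).
Proof.
move=> c0 hg A e e0; have [t t0 ht] := hg A _ (divr_gt0 e0 c0).
exists t => // B /ht; rewrite -mulrBr normrM (gtr0_norm c0) ltr_pdivlMr//.
by rewrite mulrC.
Qed.

Lemma pcont_entries (F : PD R N -> 'M[C]_N) i j : (forall A, herm (F A)) ->
  (forall v, pcont (fun A => rq (F A) v)) ->
  pcont (fun A => re (F A i j)) /\ pcont (fun A => im (F A i j)).
Proof.
move=> hF cF; have i2 : 0 < 2^-1 :> R by rewrite invr_gt0.
split.
  have -> : (fun A => re (F A i j)) = (fun A => 2^-1 * (rq (F A) (pv1 i j) -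
      rq (F A) (delta_mx i 0) - rq (F A) (delta_mx j 0))).
    by apply/funext => A; rewrite re_polar// mulrC.
  by apply: pcontZ => //; apply: pcontB => //; exact: pcontB.
have -> : (fun A => im (F A i j)) = (fun A => 2^-1 * (rq (F A) (delta_mx i 0) -
    (rq (F A) (pv2 i j) - rq (F A) (delta_mx j 0)))).
  by apply/funext => A; rewrite im_polar//; field.
by apply: pcontZ => //; apply: pcontB => //; exact: pcontB.
Qed.

End hmono.

(** * Continuity of the ordered eigenvalues *)

Section eigdiag.
Context {R : realType} {N : nat}.
Local Notation C := (Cx R).
Implicit Types (A B : PD R N).

Definition kyfan k (A : PD R N) : R := \sum_(i < N | (i < k)%N) eigvals A 0 i.

Lemma kyfan_ge0 k A : 0 <= kyfan k A.
Proof. by apply: sumr_ge0 => i _; apply/ltW/eigvals_gt0/PD_posdef. Qed.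

(** The top eigenvectors of [A] attain the Ky Fan sum of [A] and are trial vectors for that of
    [B]. *)
Lemma kyfan_hmono k : (k <= N)%N -> hmono (kyfan k).
Proof.
move=> kN c A B c1 AB; case: (posnP k) => [->|k0]; first by rewrite /kyfan !big_pred0// mulr0.
have [V [V1 VA _]] := top_eigenvectors kN (posdef_herm (PD_pd A)).
rewrite /kyfan -VA; apply: (@le_trans _ _ (c * \sum_j rq B (V *m delta_mx j 0))).
  by rewrite mulr_sumr; apply: ler_sum => j _; rewrite -rqZ.
apply: ler_wpM2l; first lra.
by apply: kyfan_le => //; [exact: posdef_herm (PD_pd B)|rewrite k0].
Qed.

(** Each ordered eigenvalue is a difference of two consecutive Ky Fan sums, which are continuous as
    monotone homogeneous functions. *)
Lemma eigvals_pcont (i : 'I_N) : pcont (fun A : PD R N => eigvals A 0 i).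
Proof.
have -> : (fun A : PD R N => eigvals A 0 i) = (fun A => kyfan i.+1 A - kyfan i A).
  apply/funext => A; rewrite /kyfan (big_lt_recr _ (ltn_ord i)) /= addrAC subrr add0r.
  by congr (eigvals _ _ _); exact: val_inj.
by apply: pcontB; apply: hmono_pcont => [A|]; rewrite ?kyfan_ge0//; apply: kyfan_hmono => //; exact: ltnW.
Qed.

Lemma eigdiagE A : eigdiag A = rdiag (eigvals A) :> 'M[C]_N.
Proof. by rewrite rdiag.unlock. Qed.

Lemma mxcloseW (t t' : R) (A B : 'M[C]_N) : t <= t' -> mxclose t A B -> mxclose t' A B.
Proof.
by move=> tt h i j; have [h1 h2] := h i j; split; apply: lt_le_trans tt.
Qed.

Lemma pcont_fin (I : finType) (g : I -> PD R N -> R) : (forall i, pcont (g i)) ->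
  forall A (e : R), 0 < e -> exists2 t : R, 0 < t &
    forall B, mxclose t A B -> forall i, `|g i B - g i A| < e.
Proof.
move=> hg A e e0.
have /choice[t ht] : forall i, exists t : R, 0 < t /\
    forall B, mxclose t A B -> `|g i B - g i A| < e.
  by move=> i; have [t] := hg i A e e0; exists t.
have s0 : 0 < 1 + \sum_i (t i)^-1.
  by apply: ltr_wpDr => //; apply: sumr_ge0 => i _; rewrite invr_ge0 ltW//; have [] := ht i.
exists (1 + \sum_i (t i)^-1)^-1; first by rewrite invr_gt0.
move=> B AB i; have [ti0] := ht i; apply; apply: mxcloseW AB.
rewrite -[leRHS]invrK lef_pV2 ?posrE ?invr_gt0// (bigD1 i)//= addrCA lerDl.
by apply: addr_ge0 => //; apply: sumr_ge0 => j _; rewrite invr_ge0 ltW//; have [] := ht j.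
Qed.

Definition mcont (s : PD R N -> PD R N) := forall A (e : R), 0 < e ->
  exists2 t : R, 0 < t & forall B, mxclose t A B -> mxclose e (s A) (s B).

Lemma mcont_id : mcont id.
Proof. by move=> A e e0; exists e. Qed.

Lemma pcont_comp g s : pcont g -> mcont s -> pcont (g \o s).
Proof.
move=> hg hs A e e0; have [t t0 ht] := hg (s A) e e0.
have [u u0 hu] := hs A t t0; exists u => // B /hu; exact: ht.
Qed.

Lemma eigdiag_mcont : mcont eigdiag.
Proof.
move=> A e e0; have [t t0 ht] := pcont_fin eigvals_pcont A e0.
exists t => // B /ht h i j; rewrite !eigdiagE rdiag.unlock !mxE.
case: eqVneq => [->|ij]; last by rewrite !mulr0n subrr !raddf0 normr0.
rewrite !mulr1n -rmorphB rcK distrC; split; first by have := h j; rewrite !mxE.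
by rewrite /im /= normr0.
Qed.

Lemma mcont_measurable (s : PD R N -> PD R N) : mcont s ->
  measurable_fun [set: borel (PD R N)] (s : borel (PD R N) -> borel (PD R N)).
Proof.
move=> hs; apply: (@measurability _ _ (borel (PD R N)) (borel (PD R N)) _ _ (@open (PD R N)) erefl).
move=> _ [G oG <-]; rewrite setTI; apply: borel_open; apply/openPDP => A /= OA.
move/openPDP: oG => /(_ _ OA)[e e0 he].
have [t t0 ht] := hs A e e0; exists t => // B /ht; exact: he.
Qed.

End eigdiag.

(** * The support has full measure *)

Section support.
Context {R : realType} {N : nat}.
Local Notation C := (Cx R).
Local Notation BPD := (borel (PD R N)).

(** A base of the topology. The index type is countable, so that boxes can be enumerated through
    [unpickle]. *)
Definition ratbox (q : 'M[rat * rat]_N * nat) : set (PD R N) :=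
  [set A | forall i j, `|re ((A : 'M[C]_N) i j) - ratr (q.1 i j).1| < q.2.+1%:R^-1 /\
                       `|im ((A : 'M[C]_N) i j) - ratr (q.1 i j).2| < q.2.+1%:R^-1].

Lemma ratbox_open q : open (ratbox q).
Proof.
apply/openPDP => A hA; pose z := q.2.+1%:R^-1 : R.
pose x i j := `|re ((A : 'M[C]_N) i j) - ratr (q.1 i j).1|.
pose y i j := `|im ((A : 'M[C]_N) i j) - ratr (q.1 i j).2|.
(* [s^-1] lies below all the margins [z - x i j] and [z - y i j]. *)
pose s := 1 + \sum_i \sum_j ((z - x i j)^-1 + (z - y i j)^-1).
have p i j : 0 <= (z - x i j)^-1 /\ 0 <= (z - y i j)^-1.
  by have [h1 h2] := hA i j; rewrite !invr_ge0 !subr_ge0 !ltW.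
have s0 : 0 < s.
  apply: ltr_wpDr => //; apply: sumr_ge0 => i _; apply: sumr_ge0 => j _.
  by have [] := p i j; exact: addr_ge0.
have sb i j : (z - x i j)^-1 <= s /\ (z - y i j)^-1 <= s.
  have h : (z - x i j)^-1 + (z - y i j)^-1 <= s.
    rewrite /s (bigD1 i)//= (bigD1 j)//= addrCA -!addrA addrA lerDl.
    rewrite !addr_ge0//; last first.
      by apply: sumr_ge0 => k _; apply: sumr_ge0 => l _; have [] := p k l; exact: addr_ge0.
    by apply: sumr_ge0 => l _; have [] := p i l; exact: addr_ge0.
  by have [p1 p2] := p i j; split; lra.
exists s^-1; first by rewrite invr_gt0.
move=> B AB i j; have [h1 h2] := AB i j; have [s1 s2] := sb i j; have [k1 k2] := hA i j.
have b1 : s^-1 <= z - x i j.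
  by rewrite -[leRHS]invrK lef_pV2 ?posrE ?invr_gt0 ?subr_gt0.
have b2 : s^-1 <= z - y i j.
  by rewrite -[leRHS]invrK lef_pV2 ?posrE ?invr_gt0 ?subr_gt0.
move: h1 h2; rewrite !raddfB /= => h1 h2; rewrite -/z; split.
  have := ler_distD (re ((A : 'M[C]_N) i j)) (re ((B : 'M[C]_N) i j)) (ratr (q.1 i j).1).
  rewrite [Y in _ <= Y + _]distrC -/(x i j); lra.
have := ler_distD (im ((A : 'M[C]_N) i j)) (im ((B : 'M[C]_N) i j)) (ratr (q.1 i j).2).
rewrite [Y in _ <= Y + _]distrC -/(y i j); lra.
Qed.

Lemma ratbox_approx (A : PD R N) (e : R) : 0 < e ->
  exists2 q, ratbox q A & forall B : PD R N, ratbox q B -> mxclose e A B.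
Proof.
move=> e0; have e2 : 0 < e / 2 by rewrite divr_gt0.
have [n hn] : exists n, n.+1%:R^-1 < e / 2.
  exists (Num.truncn (e / 2)^-1); rewrite -[ltRHS]invrK ltf_pV2 ?posrE ?invr_gt0//.
  have i0 : 0 <= (e / 2)^-1 by rewrite invr_ge0 ltW.
  by have /andP[] := truncn_itv i0.
have n0 : 0 < n.+1%:R^-1 :> R by rewrite invr_gt0.
have ap (x : R) : exists q : rat, `|x - ratr q| < n.+1%:R^-1.
  have [|q] := @rat_in_itvoo R (x - n.+1%:R^-1) (x + n.+1%:R^-1); first by rewrite ltrD2l gtrN.
  by rewrite in_itv /= => hq; exists q; rewrite ltr_distlC.
have /choice[a ha] := ap.
exists (\matrix_(i, j) (a (re ((A : 'M[C]_N) i j)), a (im ((A : 'M[C]_N) i j))), n).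
  by move=> i j; rewrite /= mxE.
move=> B hB i j; have := hB i j; rewrite /= mxE /= !raddfB /= => -[b1 b2].
have := ha (im ((A : 'M[C]_N) i j)); have := ha (re ((A : 'M[C]_N) i j)).
move: b1 b2 hn; move: (n.+1%:R^-1) => z; rewrite !ltr_norml.
move=> /andP[? ?] /andP[? ?] ? /andP[? ?] /andP[? ?].
by split; apply/andP; split; lra.
Qed.

(** A point outside the support has a null open neighbourhood, hence lies in a null rational box;
    there are countably many of these. *)
Lemma ae_msupport (mu : {measure set BPD -> \bar R}) :
  {ae mu, forall A, msupport mu A}.
Proof.
pose F (k : nat) : set BPD := if unpickle k is Some q then
  (if `[< mu (ratbox q) = 0%E >] then ratbox q else set0) else set0.
apply: (@negligibleS _ _ _ _ (\bigcup_k F k)); last first.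
  apply: negligible_bigcup => k; rewrite /F.
  case: unpickle => [q|]; last exact: negligible_set0.
  case: asboolP => [h|_]; last exact: negligible_set0.
  by apply/negligibleP => //; apply: borel_open; exact: ratbox_open.
move=> A /= /existsNP[G /not_implyP[oG /not_implyP[OA nO]]].
have mO0 : mu G = 0%E.
  by apply/eqP; rewrite eq_le measure_ge0 andbT leNgt; exact/negP.
move/openPDP: (oG) => /(_ _ OA)[e e0 he].
have [q qA hq] := ratbox_approx A e0.
exists (pickle q) => //; rewrite /F pickleK asboolT//.
apply/eqP; rewrite eq_le measure_ge0 andbT -mO0 le_measure ?inE//.
- by apply: borel_open; exact: ratbox_open.
- exact: borel_open.
- by move=> B /hq; exact: he.
Qed.

End support.

(** * Integration of Hermitian matrices *)

Section integration.
Context {R : realType} {N : nat}.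
Local Notation C := (Cx R).
Local Notation BPD := (borel (PD R N)).
Variable mu : probability BPD R.

Definition Int (f : PD R N -> R) := mu.-integrable [set: BPD] (EFin \o f).
Definition Ex (f : PD R N -> R) : R := \int[mu]_(A in [set: BPD]) f A.

Lemma IntD f g : Int f -> Int g -> Int (fun A => f A + g A).
Proof. by move=> hf hg; exact: (integrableD measurableT hf hg). Qed.

Lemma ExD f g : Int f -> Int g -> Ex (fun A => f A + g A) = Ex f + Ex g.
Proof. by move=> hf hg; exact: RintegralD. Qed.

Lemma IntZ c f : Int f -> Int (fun A => c * f A).
Proof. by move=> hf; exact: (integrableZl measurableT c hf). Qed.

Lemma ExZ c f : Int f -> Ex (fun A => c * f A) = c * Ex f.
Proof. by move=> hf; exact: RintegralZl. Qed.

Lemma eqInt f g : f =1 g -> Int f -> Int g.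
Proof. by move=> /funext ->. Qed.

Lemma eqEx f g : f =1 g -> Ex f = Ex g.
Proof. by move=> /funext ->. Qed.

Lemma Int0 : Int (fun=> 0).
Proof. exact: integrable0. Qed.

Lemma Ex_cst c : Ex (fun=> c) = c.
Proof.
by rewrite /Ex Rintegral_cst//= probability_setT mulr1.
Qed.

Lemma Int_cst c : Int (fun=> c).
Proof. exact: finite_measure_integrable_cst. Qed.

Lemma Int_Ex_sum (I : Type) (l : seq I) (P : pred I) (f : I -> PD R N -> R) :
  (forall i, P i -> Int (f i)) ->
  Int (fun A => \sum_(i <- l | P i) f i A) /\
  Ex (fun A => \sum_(i <- l | P i) f i A) = \sum_(i <- l | P i) Ex (f i).
Proof.
move=> hf; elim: l => [|i l [IH1 IH2]].
  split; first by apply: eqInt Int0 => A; rewrite big_nil.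
  by rewrite big_nil -[RHS]Ex_cst; apply: eqEx => A; rewrite big_nil.
case Pi : (P i); last first.
  split; first by apply: eqInt IH1 => A; rewrite big_cons Pi.
  by rewrite big_cons Pi -IH2; apply: eqEx => A; rewrite big_cons Pi.
split.
  by apply: (eqInt _ (IntD (hf i Pi) IH1)) => A; rewrite big_cons Pi.
rewrite big_cons Pi -IH2 -ExD//; last exact: hf.
by apply: eqEx => A; rewrite big_cons Pi.
Qed.

Lemma ae_imp (P Q : PD R N -> Prop) : {ae mu, forall A, P A} ->
  (forall A, P A -> Q A) -> {ae mu, forall A, Q A}.
Proof.
by move=> hP PQ; apply: (negligibleS _ hP) => A /=; apply: contra_not; exact: PQ.
Qed.

Lemma Ex_le_ae f g : Int f -> Int g -> (forall A, 0 <= f A) -> (forall A, 0 <= g A) ->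
  {ae mu, forall A, f A <= g A} -> Ex f <= Ex g.
Proof.
move=> hf hg f0 g0 fg; rewrite /Ex /Rintegral.
apply: fine_le; [exact: integrable_fin_num|exact: integrable_fin_num|].
have [mf _] := integrableP _ _ _ hf; have [mg _] := integrableP _ _ _ hg.
apply: ae_ge0_le_integral => //.
- by move=> A _; rewrite lee_fin.
- by move=> A _; rewrite lee_fin.
- by apply: (ae_imp fg) => A h _; rewrite lee_fin.
Qed.

Lemma Ex_le f g : Int f -> Int g -> (forall A, f A <= g A) -> Ex f <= Ex g.
Proof. by move=> hf hg fg; apply: le_Rintegral. Qed.

Lemma Int_bounded (f : PD R N -> R) (c : R) : measurable_fun [set: BPD] f -> (forall A, 0 <= f A) ->
  {ae mu, forall A, f A <= c} -> Int f.
Proof.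
move=> mf f0 fc; apply/integrableP; split.
  exact/measurable_realfun.measurable_EFinP.
have -> : (fun x => `|(EFin \o f) x|%E) = EFin \o f.
  by apply/funext => A /=; rewrite ger0_norm.
(* The maximum with 0 gives a nonnegative dominating constant whatever [c] is. *)
apply: (@le_lt_trans _ _ (\int[mu]_(x in [set: BPD]) (Num.max c 0)%:E)%E); last first.
  by rewrite integral_cst//= probability_setT mule1 ltry.
apply: ae_ge0_le_integral => //.
- by move=> A _; rewrite lee_fin.
- exact/measurable_realfun.measurable_EFinP.
- by move=> A _; rewrite lee_fin le_max lexx orbT.
- by apply: (ae_imp fc) => A h _; rewrite lee_fin le_max h.
Qed.

Lemma Int_entries (F : PD R N -> 'M[C]_N) : (forall A, herm (F A)) ->
  (forall v, Int (fun A => rq (F A) v)) -> forall i j,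
  Int (fun A => re (F A i j)) /\ Int (fun A => im (F A i j)).
Proof.
move=> hF iF i j; split.
  have h := IntZ 2^-1 (IntD (iF (pv1 i j)) (IntD (IntZ (-1) (iF (delta_mx i 0)))
    (IntZ (-1) (iF (delta_mx j 0))))).
  by apply: eqInt h => A; rewrite re_polar//; field.
have h := IntZ 2^-1 (IntD (IntZ (-1) (iF (pv2 i j))) (IntD (iF (delta_mx i 0))
  (iF (delta_mx j 0)))).
by apply: eqInt h => A; rewrite im_polar//; field.
Qed.

(** Exchanges the entrywise integral with quadratic forms, so that later estimates concern one real
    integral for each vector. *)
Lemma rq_mxintegral (F : PD R N -> 'M[C]_N) : (forall A, herm (F A)) ->
  (forall v, Int (fun A => rq (F A) v)) ->
  herm (mxintegral mu F) /\
  forall v, rq (mxintegral mu F) v = Ex (fun A => rq (F A) v).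
Proof.
move=> hF iF; set M := mxintegral mu F.
have rM i j : re (M i j) = Ex (fun A => re (F A i j)) by rewrite /M mxE.
have iM i j : im (M i j) = Ex (fun A => im (F A i j)) by rewrite /M mxE.
clearbody M.
have rI i j := (Int_entries hF iF i j).1; have iI i j := (Int_entries hF iF i j).2.
split.
  rewrite herm.unlock; apply/matrixP => i j; rewrite !mxE /=; apply: eq_re_im.
    by rewrite re_conj !rM; apply: eqEx => A; rewrite (hermE _ _ (hF A)) re_conj.
  rewrite im_conj !iM -mulN1r -ExZ//; apply: eqEx => A.
  by rewrite (hermE j i (hF A)) im_conj mulN1r opprK.
move=> v; rewrite rq_sum.
have reE (a z b : C) : re (a^* * z * b) = re (a^* * b) * re z + (- im (a^* * b)) * im z.
  by case: a z b => [a a'] [z z'] [b b']; rewrite /re /im /=; ring.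
have T i j : Int (fun A => re ((v i 0)^* * F A i j * v j 0)) /\
    Ex (fun A => re ((v i 0)^* * F A i j * v j 0)) = re ((v i 0)^* * M i j * v j 0).
  split.
    apply: (eqInt _ (IntD (IntZ (re ((v i 0)^* * v j 0)) (rI i j))
      (IntZ (- im ((v i 0)^* * v j 0)) (iI i j)))) => A.
    by rewrite -reE.
  rewrite reE rM iM -!ExZ// -ExD; [|exact: IntZ|exact: IntZ].
  by apply: eqEx => A; rewrite reE.
rewrite (eqEx (g := fun A => \sum_i \sum_j re ((v i 0)^* * F A i j * v j 0))); last first.
  by move=> A; rewrite rq_sum.
have S i := Int_Ex_sum (index_enum 'I_N) (P := predT) (fun j _ => (T i j).1).
have [_ ->] := Int_Ex_sum (index_enum 'I_N) (P := predT) (fun i _ => (S i).1).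
apply: eq_bigr => i _.
by rewrite (S i).2; apply: eq_bigr => j _; rewrite (T i j).2.
Qed.

End integration.

(** * Fixed points of the mean map *)

(** The map [s] lets one development serve twice: [id] gives the equation for [mu], and [eigdiag]
    the one for its pushforward, written as an integral over [mu]. *)
HB.lock Definition meanmap {R : realType} {N} (mu : set (borel (PD R N)) -> \bar R)
    (s : PD R N -> PD R N) (r : R) (X : 'M[Cx R]_N) : 'M[Cx R]_N :=
  mxintegral mu (fun A => wgeomean r X (s A)).

Section mean_map.
Context {R : realType} {N : nat}.
Local Notation C := (Cx R).
Local Notation BPD := (borel (PD R N)).
Variables (mu : probability BPD R) (s : PD R N -> PD R N) (r e : R).
Hypotheses (r0 : 0 < r) (r1 : r <= 1) (e0 : 0 < e) (e1 : e < 1) (cs : mcont s).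
Hypothesis sb : {ae mu, forall A : PD R N,
  lel (rc e)%:M (s A : 'M[C]_N) /\ lel (s A : 'M[C]_N) (rc e^-1)%:M}.

Let r01 : 0 <= r <= 1. Proof. by rewrite (ltW r0). Qed.
Let ei0 : 0 < e^-1. Proof. by rewrite invr_gt0. Qed.
Let pe : pd ((rc e)%:M : 'M[C]_N). Proof. exact: posdef_scalar. Qed.
Let pei : pd ((rc e^-1)%:M : 'M[C]_N). Proof. exact: posdef_scalar. Qed.

Local Notation meanmap := (meanmap mu s r).

Lemma rq_wgm_ge0 (X : 'M[C]_N) v (A : PD R N) : pd X -> 0 <= rq (wgm r X A) v.
Proof. by move=> pX; apply/posdef_rq_ge0/pd_wgm => //; exact: PD_pd. Qed.

Lemma rq_wgm_hmono (X : 'M[C]_N) v : pd X -> hmono (fun A : PD R N => rq (wgm r X A) v).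
Proof.
move=> pX c A B c1 AB; have c0 : 0 < c by lra.
have pB := PD_pd B.
apply: (le_trans (wgm_lel_r r01 pX (PD_pd A) (posdefZ c0 pB) AB v)).
rewrite wgmZr// rqZ; apply: ler_wpM2r; first exact: rq_wgm_ge0.
by rewrite -[leRHS]powRr1 ?(ltW c0)// ler_powR.
Qed.

Lemma rq_wgm_pcont (X : 'M[C]_N) v : pd X -> pcont (fun A : PD R N => rq (wgm r X A) v).
Proof.
move=> pX; apply: hmono_pcont => [A|]; first exact: rq_wgm_ge0.
exact: rq_wgm_hmono.
Qed.

Lemma Int_rq_wgm (X : 'M[C]_N) v : pd X -> Int mu (fun A => rq (wgm r X (s A)) v).
Proof.
move=> pX; apply: (@Int_bounded _ _ _ _ (rq (wgm r X (rc e^-1)%:M) v)).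
- apply: (@pcont_measurable _ _ ((fun A : PD R N => rq (wgm r X A) v) \o s)).
  by apply: pcont_comp => //; exact: rq_wgm_pcont.
- by move=> A; exact: rq_wgm_ge0.
- apply: (ae_imp sb) => A [_ h]; apply: wgm_lel_r => //; exact: PD_pd.
Qed.

Lemma meanmapP (X : 'M[C]_N) : pd X -> herm (meanmap X) /\
  forall v, rq (meanmap X) v = Ex mu (fun A => rq (wgm r X (s A)) v).
Proof.
move=> pX; have [] := @rq_mxintegral _ _ mu (fun A => wgm r X (s A)).
- by move=> A; apply/posdef_herm/pd_wgm => //; exact: PD_pd.
- by move=> v; exact: Int_rq_wgm.
have -> : mxintegral mu (fun A => wgm r X (s A)) = meanmap X.
  by rewrite meanmap.unlock; congr mxintegral; apply/funext => A; rewrite wgeomeanE.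
by split.
Qed.

Lemma meanmap_lel (X Y : 'M[C]_N) : pd X -> pd Y -> lel X Y ->
  lel (meanmap X) (meanmap Y).
Proof.
move=> pX pY XY v; rewrite (meanmapP pX).2 (meanmapP pY).2.
apply: Ex_le; [exact: Int_rq_wgm|exact: Int_rq_wgm|] => A.
by apply: wgm_lel_l => //; exact: PD_pd.
Qed.

Lemma meanmap_ge (X B : 'M[C]_N) : pd X -> pd B ->
  {ae mu, forall A : PD R N, lel B (wgm r X (s A))} -> lel B (meanmap X).
Proof.
move=> pX pB h v; rewrite (meanmapP pX).2 -[leLHS](Ex_cst mu).
apply: Ex_le_ae; [exact: Int_cst|exact: Int_rq_wgm| | |].
- by move=> _; exact: posdef_rq_ge0.
- by move=> A; exact: rq_wgm_ge0.
- by apply: (ae_imp h) => A; apply.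
Qed.

Lemma meanmap_le (X B : 'M[C]_N) : pd X -> pd B ->
  {ae mu, forall A : PD R N, lel (wgm r X (s A)) B} -> lel (meanmap X) B.
Proof.
move=> pX pB h v; rewrite (meanmapP pX).2 -[leRHS](Ex_cst mu).
apply: Ex_le_ae; [exact: Int_rq_wgm|exact: Int_cst| | |].
- by move=> A; exact: rq_wgm_ge0.
- by move=> _; exact: posdef_rq_ge0.
- by apply: (ae_imp h) => A; apply.
Qed.

Lemma pd_meanmap (X : 'M[C]_N) : pd X -> pd (meanmap X).
Proof.
move=> pX; have pW := pd_wgm r pX pe.
apply: (posdef_le pW); first exact: (meanmapP pX).1.
apply: meanmap_ge => //; apply: (ae_imp sb) => A [h _].
by apply: wgm_lel_r => //; exact: PD_pd.
Qed.

Lemma rq_meanmapZ c (X : 'M[C]_N) v : 0 < c -> pd X ->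
  rq (meanmap (rc c *: X)) v = c `^ (1 - r) * rq (meanmap X) v.
Proof.
move=> c0 pX; rewrite (meanmapP pX).2 (meanmapP (posdefZ c0 pX)).2 -ExZ; last exact: Int_rq_wgm.
by apply: eqEx => A; rewrite wgmZl ?rqZ//; exact: PD_pd.
Qed.

Lemma meanmap_sub (X : 'M[C]_N) : pd X -> lel X (rc e^-1)%:M ->
  lel (meanmap X) (rc e^-1)%:M.
Proof.
move=> pX Xe; apply: meanmap_le => //; apply: (ae_imp sb) => A [_ h].
rewrite -[Y in lel _ Y](wgm_id r pei).
apply: (@lel_trans _ _ (wgm r X (rc e^-1)%:M)).
  by apply: wgm_lel_r => //; exact: PD_pd.
exact: wgm_lel_l.
Qed.

Lemma meanmap_start : lel (rc e)%:M (meanmap (rc e)%:M).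
Proof.
apply: meanmap_ge => //; apply: (ae_imp sb) => A [h _].
rewrite -[Y in lel Y _](wgm_id r pe).
by apply: wgm_lel_r => //; exact: PD_pd.
Qed.

(** Monotone iteration from the lower end of the order interval from [e I] to [e^-1 I]; the iterates
    stay there because [X #_r X = X] and the mean is monotone in both arguments. *)
Definition miter n := iter n meanmap (rc e)%:M.

Lemma miterP n : [/\ pd (miter n), lel (miter n) (miter n.+1) &
  lel (miter n) (rc e^-1)%:M].
Proof.
elim: n => [|n [p1 p2 p3]]; split.
- exact: pe.
- exact: meanmap_start.
- move=> v; rewrite !rq_scalar; apply: ler_wpM2r; first exact: nrm2_ge0.
  by apply: (le_trans (ltW e1)); rewrite invf_ge1 ?ltW.
- exact: pd_meanmap.
- by apply: meanmap_lel => //; exact: pd_meanmap.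
- exact: meanmap_sub.
Qed.

Lemma miter_nd v : {homo (fun n => rq (miter n) v) : n m / (n <= m)%N >-> n <= m}.
Proof.
apply: homo_leq => [x|x y z|n]; [exact: lexx|exact: le_trans|].
by have [_ h _] := miterP n; exact: h.
Qed.

Lemma miter_cvg v : cvgn (fun n => rq (miter n) v).
Proof.
apply: nondecreasing_is_cvgn; first exact: miter_nd.
exists (rq (rc e^-1)%:M v) => _ [n _ <-]; have [_ _ h] := miterP n; exact: h.
Qed.

Lemma miter_entries_cvg i j : cvgn (fun n => re (miter n i j)) /\
  cvgn (fun n => im (miter n i j)).
Proof.
have hh n : herm (miter n) by have [p _ _] := miterP n; exact: posdef_herm.
have q v := @miter_cvg v.
split.
  under eq_fun => n do rewrite (re_polar _ _ (hh n)).
  exact: (cvgP _ (cvgMr_tmp (b := 2^-1) (cvgB (cvgB (q (pv1 i j)) (q (delta_mx i 0)))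
    (q (delta_mx j 0))))).
under eq_fun => n do rewrite (im_polar _ _ (hh n)).
exact: (cvgP _ (cvgMr_tmp (b := 2^-1) (cvgB (cvgD (q (delta_mx i 0)) (q (delta_mx j 0)))
  (q (pv2 i j))))).
Qed.

Definition mlim : 'M[C]_N := \matrix_(i, j)
  (Complex (limn (fun n => re (miter n i j))) (limn (fun n => im (miter n i j))) : C).

Lemma re_mlim i j : re (miter n i j) @[n --> \oo] --> re (mlim i j).
Proof. by have [h _] := miter_entries_cvg i j; rewrite /mlim mxE /re /=; exact: h. Qed.

Lemma im_mlim i j : im (miter n i j) @[n --> \oo] --> im (mlim i j).
Proof. by have [_ h] := miter_entries_cvg i j; rewrite /mlim mxE /im /=; exact: h. Qed.

Lemma rq_mlim v : rq (miter n) v @[n --> \oo] --> rq mlim v.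
Proof.
have reE (a z b : C) : re (a^* * z * b) = re (a^* * b) * re z - im (a^* * b) * im z.
  by case: a z b => [a a'] [z z'] [b b']; rewrite /re /im /=; ring.
rewrite rq_sum; under eq_fun do rewrite rq_sum.
apply: cvg_big => [|i _]; first exact: add_continuous.
apply: cvg_big => [|j _]; first exact: add_continuous.
rewrite reE; under eq_fun do rewrite reE.
by apply: cvgB; apply: cvgMl_tmp; [exact: re_mlim|exact: im_mlim].
Qed.

Lemma miter_le_mlim n : lel (miter n) mlim.
Proof.
move=> v; have := nondecreasing_cvgn_le (@miter_nd v) (@miter_cvg v) n.
by rewrite (cvg_lim _ (rq_mlim (v := v))).
Qed.

Lemma herm_mlim : herm mlim.
Proof.
have hh n : herm (miter n) by have [p _ _] := miterP n; exact: posdef_herm.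
rewrite herm.unlock; apply/matrixP => i j; rewrite [LHS]mxE [_ i j]mxE /=.
apply: eq_re_im.
  rewrite re_conj; apply: (cvg_unique _ (re_mlim (i := j) (j := i)) _) => //.
  have := re_mlim (i := i) (j := j).
  by under eq_fun do rewrite (hermE _ _ (hh _)) re_conj.
rewrite im_conj; apply: (cvg_unique _ (cvgN (im_mlim (i := j) (j := i))) _) => //.
have := im_mlim (i := i) (j := j).
by under eq_fun do rewrite (hermE _ _ (hh _)) im_conj.
Qed.

Lemma pd_mlim : pd mlim.
Proof. by apply: (posdef_le pe herm_mlim); exact: (miter_le_mlim 0). Qed.

Lemma mlim_le_meanmap : lel mlim (meanmap mlim).
Proof.
move=> v; apply: (ler_cvg_to (rq_mlim (v := v)) (cvg_cst (rq (meanmap mlim) v))).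
near=> n; have [p1 p2 _] := miterP n.
apply: (le_trans (p2 v)); apply: meanmap_lel => //; first exact: pd_mlim.
exact: miter_le_mlim.
Unshelve. all: by end_near. Qed.

Lemma mxclose_miter t : 0 < t -> exists n, mxclose t mlim (miter n).
Proof.
move=> t0.
have : \forall n \near \oo, forall i j, `|re (mlim i j) - re (miter n i j)| < t /\
    `|im (mlim i j) - im (miter n i j)| < t.
  apply: filter_forall => i; apply: filter_forall => j.
  near=> n; split; near: n.
    by move/cvgrPdist_lt: (re_mlim (i := i) (j := j)); apply.
  by move/cvgrPdist_lt: (im_mlim (i := i) (j := j)); apply.
move=> [n _ /(_ n (leqnn n)) h]; exists n => i j.
by rewrite !raddfB /=; exact: h.
Unshelve. all: by end_near. Qed.

(** Some iterate dominates [(1 - dl) L], where [L] is the limit. Applying the mean map [M] gives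
    [(1 - dl)^(1 - r) M(L) <= L], and [1 - dl <= (1 - dl)^(1 - r)]; then [dl] is made small. *)
Lemma meanmap_le_mlim : lel (meanmap mlim) mlim.
Proof.
move=> v; have pL := pd_mlim.
have key (dl : R) : 0 < dl -> dl < 1 -> (1 - dl) * rq (meanmap mlim) v <= rq mlim v.
  move=> dl0 dl1; have [t t0 ht] := pd_near pL dl0.
  have [n /ht[h _]] := mxclose_miter t0; have [pn _ _] := miterP n.
  have c0 : 0 < 1 - dl by lra.
  have h1 := meanmap_lel (posdefZ c0 pL) pn h v.
  have h2 := miter_le_mlim n.+1 v.
  apply: le_trans (le_trans h1 h2); rewrite rq_meanmapZ//.
  apply: ler_wpM2r; first exact/posdef_rq_ge0/pd_meanmap.
  rewrite -[leLHS]powRr1 ?(ltW c0)//; apply: ger_powR.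
    by rewrite c0 gerBl ltW.
  by rewrite gerBl ltW.
rewrite leNgt; apply/negP => lt.
have M0 : 0 < rq (meanmap mlim) v by apply: (le_lt_trans _ lt); exact: posdef_rq_ge0.
set a := rq mlim v in lt key *; set b := rq (meanmap mlim) v in lt key M0 *.
have a0 : 0 <= a by exact: posdef_rq_ge0.
(* This value makes [(1 - dl) * b] the midpoint of [a] and [b], which exceeds [a]. *)
have dl0 : 0 < (b - a) / (2 * b) by rewrite divr_gt0 ?subr_gt0 ?mulr_gt0.
have dl1 : (b - a) / (2 * b) < 1 by rewrite ltr_pdivrMr ?mulr_gt0//; lra.
have := key _ dl0 dl1.
have -> : (1 - (b - a) / (2 * b)) * b = (b + a) / 2 by field; exact: lt0r_neq0.
lra.
Qed.

Lemma meanmap_fixpoint : exists X : PD R N,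
  X = mxintegral mu (fun A => wgeomean r X (s A)) :> 'M[C]_N.
Proof.
have pL := pd_mlim; have pL' := pL; rewrite pd.unlock in pL'.
exists (SigSub (mem_set pL') : PD R N).
rewrite -[RHS]/(mxintegral mu (fun A => wgeomean r mlim (s A))) -[LHS]/mlim.
have -> : mxintegral mu (fun A => wgeomean r mlim (s A)) = meanmap mlim.
  by rewrite meanmap.unlock.
apply: lel_anti; [exact: herm_mlim|exact: (meanmapP pL).1| |].
- exact: mlim_le_meanmap.
- exact: meanmap_le_mlim.
Qed.

End mean_map.

(** * Extremal ratio of two positive definite matrices *)

Section compare.
Context {R : realType}.
Local Notation C := (Cx R).

(** [c] is the smallest eigenvalue of [D^(-1/2) Y D^(-1/2)], the last one in decreasing order, and
    [v] is the image under [D^(-1/2)] of its eigenvector. The successor dimension makes this last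
    index exist. *)
Lemma pd_min_ratio n (D Y : 'M[C]_n.+1) : pd D -> pd Y ->
  exists (c : R) (v : 'cV[C]_n.+1),
    [/\ 0 < c, 0 < rq D v, lel (rc c *: D) Y & rq Y v = c * rq D v].
Proof.
move=> pD pY; have pB := pd_sandwich_half (- 2^-1) pD pY.
have [U [uU BE b0]] := posdef_spec_eigvals pB.
set B := _ *m _ *m _ in BE b0; pose c := eigvals B 0 ord_max.
have hH := herm_mxpow 2^-1 pD; have hHi := herm_mxpow (- 2^-1) pD.
have YE : mpw D 2^-1 *m B *m mpw D 2^-1 = Y.
  by rewrite /B !mulmxA mxpowNr// mul1mx -mulmxA mxpowN// mulmx1.
have DE : mpw D (- 2^-1) *m D *m mpw D (- 2^-1) = 1%:M.
  rewrite -[Z in _ *m Z *m _](mxpow_half pD) !mulmxA mxpowN// mul1mx.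
  by rewrite mxpowNr.
have DE' : mpw D 2^-1 *m 1%:M *m mpw D 2^-1 = D by rewrite mulmx1 mxpow_half.
pose w : 'cV[C]_n.+1 := U^t* *m delta_mx ord_max 0.
have Uw : U *m w = delta_mx ord_max 0 by rewrite mulmxA (unitarymxP uU) mul1mx.
have rqU d : rq (spec U d) w = d 0 ord_max.
  by rewrite -[spec U d]mulmx1 spec.unlock mulmx1 rq_conj Uw rq_rdiag_delta.
have rD : rq D (mpw D (- 2^-1) *m w) = 1.
  by rewrite -rq_sandwich// DE -(spec_unit uU) rqU mxE.
have rY : rq Y (mpw D (- 2^-1) *m w) = c.
  by rewrite -rq_sandwich// -/B BE rqU.
clearbody B.
exists c, (mpw D (- 2^-1) *m w); split.
- exact: b0.
- by rewrite rD.
- move=> v; rewrite rqZ -[Z in _ <= rq Z _]YE -[Z in _ * rq Z _]DE'.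
  rewrite !rq_sandwich// -(spec_unit uU) BE !rq_spec mulr_sumr; apply: ler_sum => i _.
  rewrite mxE mul1r; apply: ler_wpM2r; first exact: sq_ge0.
  by apply: eigvals_sorted; rewrite -ltnS.
- by rewrite rY rD mulr1.
Qed.

End compare.

(** * The diagonal solution and the two majorization bounds *)

Section final.
Context {R : realType} {N : nat}.
Local Notation C := (Cx R).
Local Notation BPD := (borel (PD R N)).
Variables (mu : probability BPD R) (r e : R).
Hypotheses (r0 : 0 < r) (r1 : r <= 1) (e0 : 0 < e) (e1 : e < 1).
Hypothesis ab : {ae mu, forall A : PD R N,
  lel (rc e)%:M (A : 'M[C]_N) /\ lel (A : 'M[C]_N) (rc e^-1)%:M}.

Let r01 : 0 <= r <= 1. Proof. by rewrite (ltW r0). Qed.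

(** [A] and [eigdiag A] are unitarily conjugate, and conjugation fixes scalar matrices. *)
Lemma eigdiag_lel (A : PD R N) (c : R) :
  (lel (rc c)%:M (A : 'M[C]_N) -> lel (rc c)%:M (eigdiag A : 'M[C]_N)) /\
  (lel (A : 'M[C]_N) (rc c)%:M -> lel (eigdiag A : 'M[C]_N) (rc c)%:M).
Proof.
have [U [uU AE _]] := posdef_spec_eigvals (PD_pd A).
have UU : U *m U^t* = 1%:M by exact/unitarymxP.
have rqA v : rq A (U^t* *m v) = rq (eigdiag A) v.
  by rewrite eigdiagE AE rq_spec mulmxA UU mul1mx rq_rdiag -AE.
have rqc v : rq ((rc c)%:M : 'M[C]_N) (U^t* *m v) = rq (rc c)%:M v.
  by rewrite -(spec_const c uU) rq_spec mulmxA UU mul1mx spec_const// -rdiag_const rq_rdiag.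
by split=> h v; rewrite -rqA -rqc; exact: h.
Qed.

Lemma eb : {ae mu, forall A : PD R N,
  lel (rc e)%:M (eigdiag A : 'M[C]_N) /\ lel (eigdiag A : 'M[C]_N) (rc e^-1)%:M}.
Proof.
apply: (ae_imp ab) => A [h1 h2]; have [k1 _] := eigdiag_lel A e.
by have [_ k2] := eigdiag_lel A e^-1; split; [exact: k1|exact: k2].
Qed.

(** Seen as a diagonal entry of a geometric mean with [I], the power of an eigenvalue inherits the
    integrability already proved for such means. *)
Lemma eigvals_powE (A : PD R N) i :
  eigvals A 0 i `^ r = rq (wgm r 1%:M (eigdiag A : 'M[C]_N)) (delta_mx i 0).
Proof.
rewrite eigdiagE -(spec_unit (unitary1 N)) spec1 wgm_rdiag.
- by rewrite rq_rdiag_delta !mxE powR1 mul1r.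
- by move=> j; rewrite mxE.
- by move=> j; apply: eigvals_gt0; exact: PD_posdef.
Qed.

Lemma Int_eigvals_pow i : Int mu (fun A => eigvals A 0 i `^ r).
Proof.
apply: (eqInt (fun A => esym (eigvals_powE A i))).
apply: (Int_rq_wgm r0 r1 e0 eigdiag_mcont eb).
exact: (posdef_scalar N ltr01).
Qed.

Definition dmean : 'rV[R]_N := \row_i (Ex mu (fun A => eigvals A 0 i `^ r)) `^ r^-1.

Lemma Ex_eigvals_gt0 i : 0 < Ex mu (fun A => eigvals A 0 i `^ r).
Proof.
have er : 0 < e `^ r by rewrite powR_gt0.
apply: (lt_le_trans er); rewrite -[leLHS](Ex_cst mu).
apply: Ex_le_ae; [exact: Int_cst|exact: Int_eigvals_pow| | |].
- by move=> _; exact: ltW.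
- by move=> A; exact: powR_ge0.
apply: (ae_imp eb) => A [h _]; apply: ge0_ler_powR; rewrite ?nnegrE ?(ltW r0) ?(ltW e0)//.
  exact/ltW/eigvals_gt0/PD_posdef.
have := h (delta_mx i 0); rewrite eigdiagE rq_rdiag_delta.
by rewrite -rdiag_const rq_rdiag_delta mxE.
Qed.

Lemma dmean_gt0 i : 0 < dmean 0 i.
Proof. by rewrite mxE powR_gt0// Ex_eigvals_gt0. Qed.

Lemma dmean_pow i : dmean 0 i `^ r = Ex mu (fun A => eigvals A 0 i `^ r).
Proof.
by rewrite mxE -powRrM mulVf ?lt0r_neq0// powRr1// ltW// Ex_eigvals_gt0.
Qed.

Lemma pd_dmean : pd (rdiag dmean : 'M[C]_N).
Proof.
rewrite -spec1; apply: posdef_spec; [exact: unitary1|exact: dmean_gt0].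
Qed.

(** Diagonal matrices commute, so the equation splits into the scalar ones [d = d^(1 - r) * d^r]. *)
Lemma dmean_fixpoint : meanmap mu eigdiag r (rdiag dmean) = rdiag dmean :> 'M[C]_N.
Proof.
have [hM qM] := meanmapP r0 r1 e0 eigdiag_mcont eb pd_dmean.
apply: herm_rq_eq => //; first exact: herm_rdiag.
move=> v; rewrite qM rq_rdiag.
pose c i := dmean 0 i `^ (1 - r) * sq (v i 0).
rewrite (@eqEx _ _ mu _ (fun A => \sum_i c i * eigvals A 0 i `^ r)); last first.
  move=> A; rewrite eigdiagE wgm_rdiag ?rq_rdiag.
  - by apply: eq_bigr => i _; rewrite [(\row__ _) _ _]mxE /c mulrAC.
  - exact: dmean_gt0.
  - by move=> j; apply: eigvals_gt0; exact: PD_posdef.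
have [_ ->] := Int_Ex_sum (mu := mu) (index_enum 'I_N) (P := predT)
  (fun i _ => IntZ (c i) (Int_eigvals_pow i)).
apply: eq_bigr => i _; rewrite ExZ; last exact: Int_eigvals_pow.
rewrite -dmean_pow /c mulrAC -powRD; last by apply/implyP => _; rewrite gt_eqF// dmean_gt0.
by rewrite subrK powRr1// ltW// dmean_gt0.
Qed.

(** A change of variables for the real and imaginary parts of each entry; continuity of [eigdiag]
    and of the geometric mean in [A] gives the measurability it requires. *)
Lemma mxintegral_eig_pushforward (Y : PD R N) :
  mxintegral (eig_pushforward mu) (fun A => wgeomean r Y A) = meanmap mu eigdiag r Y.
Proof.
have me := mcont_measurable (@eigdiag_mcont R N); have pY := PD_pd Y.
have hW (A : PD R N) : herm (wgm r Y A) by apply/posdef_herm/pd_wgm => //; exact: PD_pd.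
have cW i j := pcont_entries i j hW (fun v => rq_wgm_pcont r0 r1 v pY).
have iW i j := Int_entries (fun A => hW (eigdiag A))
  (fun v => Int_rq_wgm r0 r1 e0 eigdiag_mcont eb v pY) i j.
rewrite meanmap.unlock; apply/matrixP => i j; rewrite [LHS]mxE [RHS]mxE.
have E (f : PD R N -> R) : pcont f -> Int mu (f \o eigdiag) ->
    (\int[eig_pushforward mu]_(A in [set: BPD]) (f A)%:E =
     \int[mu]_(A in [set: BPD]) (f (eigdiag A))%:E)%E.
  move=> cf If; rewrite /eig_pushforward.
  rewrite (@integral_pushforward _ _ _ _ _ _ me mu setT (EFin \o f))//.
  by apply/measurable_realfun.measurable_EFinP; exact: pcont_measurable cf.
rewrite (E (fun A => re (wgeomean r Y A i j))).
- rewrite (E (fun A => im (wgeomean r Y A i j))) //.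
  + rewrite (_ : (fun A : PD R N => im (wgeomean r Y A i j)) = fun A => im (wgm r Y A i j)).
      by have [] := cW i j.
    by apply/funext => A; rewrite wgeomeanE.
  + apply: eqInt (iW i j).2 => A; rewrite /= wgeomeanE //.
- rewrite (_ : (fun A : PD R N => re (wgeomean r Y A i j)) = fun A => re (wgm r Y A i j)).
    by have [] := cW i j.
  by apply/funext => A; rewrite wgeomeanE.
- by apply: eqInt (iW i j).1 => A; rewrite /= wgeomeanE.
Qed.

Lemma sum_eigvals_fixpoint_le k (X : 'M[C]_N) : pd X -> meanmap mu id r X = X ->
  (0 < k <= N)%N ->
  \sum_(i < N | (i < k)%N) eigvals X 0 i <= \sum_(i < N | (i < k)%N) dmean 0 i.
Proof.
move=> pX XE kN; have /andP[k0 kN'] := kN.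
(* These are eigenvectors of [X], hence independent of [A], so that the integral passes through the
   sum over them. *)
have [V [V1 VX _]] := top_eigenvectors kN' (posdef_herm pX).
have [_ [_ _ x0]] := posdef_spec_eigvals pX.
have cid := @mcont_id R N.
have iX v := Int_rq_wgm r0 r1 e0 cid ab v pX.
have [_ qX] := meanmapP r0 r1 e0 cid ab pX.
have [iS eS] := Int_Ex_sum (mu := mu) (index_enum 'I_k) (P := predT)
  (fun j _ => iX (V *m delta_mx j 0)).
have [iT eT] := Int_Ex_sum (mu := mu) (index_enum 'I_N) (P := fun i => (i < k)%N)
  (fun i _ => IntZ (eigvals X 0 i `^ (1 - r)) (Int_eigvals_pow i)).
have h1 : \sum_(i < N | (i < k)%N) eigvals X 0 i <=
    \sum_(i < N | (i < k)%N) eigvals X 0 i `^ (1 - r) * dmean 0 i `^ r.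
  rewrite -[leLHS]VX (eq_bigr (fun j => Ex mu (fun A => rq (wgm r X A) (V *m delta_mx j 0)))).
    rewrite -eS [leRHS](_ : _ = Ex mu (fun A => \sum_(i < N | (i < k)%N)
        eigvals X 0 i `^ (1 - r) * eigvals A 0 i `^ r)); last first.
      rewrite eT; apply: eq_bigr => i _; rewrite ExZ ?dmean_pow//.
      exact: Int_eigvals_pow.
    apply: Ex_le => // A; have pA := PD_pd A.
    apply: le_trans (wgm_weakmaj r01 pX pA kN').
    by apply: kyfan_le => //; apply/posdef_herm/pd_wgm.
  by move=> j _; rewrite -{1}XE qX.
have h2 : \sum_(i < N | (i < k)%N) eigvals X 0 i `^ (1 - r) * dmean 0 i `^ r <=
    (1 - r) * (\sum_(i < N | (i < k)%N) eigvals X 0 i) +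
    r * (\sum_(i < N | (i < k)%N) dmean 0 i).
  rewrite !mulr_sumr -big_split /=; apply: ler_sum => i _.
  by apply: powR_young => //; exact: dmean_gt0.
have h := le_trans h1 h2; move: (\sum_(i < N | _) _) (\sum_(i < N | _) _) h => x d h.
by rewrite -(ler_pM2l r0); lra.
Qed.

End final.

Section final_succ.
Context {R : realType} {n : nat}.
Local Notation C := (Cx R).
Local Notation N := n.+1.
Local Notation BPD := (borel (PD R N)).
Variables (mu : probability BPD R) (r e : R).
Hypotheses (r0 : 0 < r) (r1 : r <= 1) (e0 : 0 < e) (e1 : e < 1).
Hypothesis ab : {ae mu, forall A : PD R N,
  lel (rc e)%:M (A : 'M[C]_N) /\ lel (A : 'M[C]_N) (rc e^-1)%:M}.

(* If [c] is the largest number with [c D <= Y], applying the mean map gives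
   [c^(1-r) D <= Y], hence [c >= 1]. *)
Lemma dmean_lel_fixpoint (Y : 'M[C]_N) : pd Y -> meanmap mu eigdiag r Y = Y ->
  lel (rdiag (dmean mu r)) Y.
Proof.
move=> pY YE; have pD := pd_dmean r0 r1 e0 ab; set D := rdiag _ in pD *.
have DE : meanmap mu eigdiag r D = D := dmean_fixpoint r0 r1 e0 ab.
have [c [v [c0 Dv0 cD Yv]]] := pd_min_ratio pD pY.
have eB := eb ab.
(* At the contact vector [v], where the forms of [Y] and [c D] agree, the comparison reduces to
   [c^(1 - r) <= c]. *)
have := meanmap_lel r0 r1 e0 eigdiag_mcont eB (posdefZ c0 pD) pY cD v.
rewrite (rq_meanmapZ r0 r1 e0 eigdiag_mcont eB v c0 pD) YE DE Yv ler_pM2r// => hc.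
have c1 : 1 <= c.
  rewrite leNgt; apply/negP => c1.
  have p1 : 1 `^ r = 1 :> R by rewrite powR1.
  have cr : c `^ r < 1 by rewrite -[ltRHS]p1 gt0_ltr_powR ?nnegrE ?(ltW c0).
  have cE : c `^ (1 - r) * c `^ r = c.
    by rewrite -powRD ?subrK ?powRr1 ?(ltW c0)//; apply/implyP => _; rewrite gt_eqF.
  move: hc; rewrite -[leRHS]cE -[leLHS]mulr1 ler_pM2l ?powR_gt0//.
  by rewrite leNgt cr.
move=> w; apply: le_trans (cD w); rewrite rqZ.
by rewrite ler_peMl// posdef_rq_ge0.
Qed.

(** The first [k] basis vectors are trial vectors in Ky Fan's principle for [Y], and there the form
    of [Y] dominates the entries of [dmean]. *)
Lemma sum_dmean_le k (Y : 'M[C]_N) : pd Y -> meanmap mu eigdiag r Y = Y ->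
  (0 < k <= N)%N ->
  \sum_(i < N | (i < k)%N) dmean mu r 0 i <= \sum_(i < N | (i < k)%N) eigvals Y 0 i.
Proof.
move=> pY YE kN; have /andP[k0 kN'] := kN.
apply: le_trans (kyfan_le (posdef_herm pY) (idcols_isometry kN') kN).
rewrite (sum_narrow kN'); apply: ler_sum => j _.
apply: le_trans (dmean_lel_fixpoint pY YE _).
rewrite -rq_conj -[Z in rq Z _](_ : spec (idcols N k) (dmean mu r) = _); last by rewrite spec.unlock.
by rewrite (spec_idcols kN') rq_rdiag_delta mxE.
Qed.

End final_succ.

(** [get] returns a default point when its set is empty, so the equation is available only once a
    solution exists. *)
Lemma power_meanP (R : realType) (N : nat) (r : R) (nu : set (borel (PD R N)) -> \bar R) :
  (exists X : PD R N, X = mxintegral nu (fun A => wgeomean r X A) :> 'M[Cx R]_N) ->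
  power_mean r nu = mxintegral nu (fun A => wgeomean r (power_mean r nu) A) :> 'M[Cx R]_N.
Proof.
pose S := [set X : PD R N | X = mxintegral nu (fun A => wgeomean r X A) :> 'M[Cx R]_N].
by move=> [X hX]; exact: (@getPex _ S (ex_intro _ X hX)).
Qed.

Lemma bounded_support_ae (R : realType) (N : nat) (mu : probability (borel (PD R N)) R) :
  bounded_support mu -> exists2 e : R, 0 < e < 1 & {ae mu, forall A : PD R N,
    lel (rc e)%:M (A : 'M[Cx R]_N) /\ lel (A : 'M[Cx R]_N) (rc e^-1)%:M}.
Proof.
move=> [e [e0 e1 he]]; exists e; first by rewrite e0.
apply: (ae_imp (ae_msupport mu)) => A hA.
have [h1 h2] := he A hA.
by split; [exact: (loewner_le_lel h1)|exact: (loewner_le_lel h2)].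
Qed.

Theorem proposition7p5 (R : realType) (N : nat) (r : R)
    (mu : probability (borel (PD R N)) R) :
  0 < r -> r <= 1 -> bounded_support mu ->
  power_mean r mu ≺w power_mean r (eig_pushforward mu).
Proof.
move=> r0 r1 /bounded_support_ae[e /andP[e0 e1] ab].
(* In dimension 0 no [k] satisfies [1 <= k <= N]; the comparison of fixed points takes place in a
   successor dimension. *)
case: N mu ab => [|n] mu ab k kN.
  by exfalso; clear -kN; case: k kN.
have XE : meanmap mu id r (power_mean r mu) = power_mean r mu.
  rewrite meanmap.unlock; apply/esym/power_meanP.
  exact: (meanmap_fixpoint r0 r1 e0 e1 (@mcont_id R n.+1) ab).
have YE : meanmap mu eigdiag r (power_mean r (eig_pushforward mu)) =
    power_mean r (eig_pushforward mu).
  have pD := pd_dmean r0 r1 e0 ab; have pD' := pD; rewrite pd.unlock in pD'.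
  rewrite -(mxintegral_eig_pushforward r0 r1 e0 ab); apply/esym/power_meanP.
  exists (SigSub (mem_set pD') : PD R n.+1).
  rewrite (mxintegral_eig_pushforward r0 r1 e0 ab).
  exact/esym/(dmean_fixpoint r0 r1 e0 ab).
apply: le_trans (sum_dmean_le r0 r1 e0 ab (PD_pd _) YE kN).
exact: (sum_eigvals_fixpoint_le r0 r1 e0 ab (PD_pd _) XE kN).
Qed.
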